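(* Consider problem (P4), over $\boldsymbol W\in\mathbb C^{N_t\times N_t}$: $$\max_{\boldsymbol W}\ \mathrm{tr}(\boldsymbol A_1\boldsymbol W)\quad\text{s.t.}\quad \log_2\left|\boldsymbol I_{N_u}+\frac{\boldsymbol H\boldsymbol W\boldsymbol H^H}{\sigma_c^2}\right|\ge\bar R,\quad \mathrm{tr}(\boldsymbol W)\le P,\quad \boldsymbol W\succeq\boldsymbol 0 .$$ Let $\boldsymbol s_1$ be the (unit-norm) eigenvector corresponding to the largest eigenvalue of $\boldsymbol A_1$, let $R_s^U=\log_2\left|\boldsymbol I_{N_u}+\frac{P\boldsymbol H\boldsymbol s_1\boldsymbol s_1^H\boldsymbol H^H}{\sigma_c^2}\right|$, and let $R_{\max}$ be the maximum of $\log_2\left|\boldsymbol I_{N_u}+\boldsymbol H\boldsymbol W\boldsymbol H^H/\sigma_c^2\right|$ over $\boldsymbol W\succeq\boldsymbol 0$, $\mathrm{tr}(\boldsymbol W)\le P$. Suppose $R_s^U<\bar R\le R_{\max}$, and let $\beta^\star$ and $\mu^\star$ be the (unique) optimal dual variables of (P4) associated with the rate and power constraints, respectively. Then the optimal solution to (P4) is given by $$\boldsymbol W_U^\star=\boldsymbol Q^{-\frac12}\tilde{\boldsymbol V}\tilde{\boldsymbol\Lambda}\tilde{\boldsymbol V}^H\boldsymbol Q^{-\frac12}.$$ Here $\boldsymbol Q=\frac{\mu^\star}{\beta^\star}\boldsymbol I_{N_t}-\frac{1}{\beta^\star}\boldsymbol A_1$; $\boldsymbol H\boldsymbol Q^{-\frac12}=\tilde{\boldsymbol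 U}\tilde{\boldsymbol\Gamma}^{\frac12}\tilde{\boldsymbol V}^H$ is the (reduced) singular value decomposition of $\boldsymbol H\boldsymbol Q^{-\frac12}$, with $T=\mathrm{rank}(\boldsymbol H)$, $\tilde{\boldsymbol\Gamma}=\mathrm{diag}\{\tilde h_1,\dots,\tilde h_T\}$, and $\tilde{\boldsymbol U}\in\mathbb C^{N_u\times T}$, $\tilde{\boldsymbol V}\in\mathbb C^{N_t\times T}$ having orthonormal columns; and $\tilde{\boldsymbol\Lambda}=\mathrm{diag}\{\tilde v_1,\dots,\tilde v_T\}$ with $\tilde v_i=(1/\ln2-\sigma_c^2/\tilde h_i)^+$, $i=1,\dots,T$.
   Context: $N_t,N_r,N_u\ge1$ are the numbers of base-station transmit antennas, base-station receive antennas and user antennas; $P$ is the transmit power budget; $\bar R$ is the communication rate threshold; $\sigma_c^2$ is the noise power at the user. $\boldsymbol H\in\mathbb C^{N_u\times N_t}$ is the channel matrix to the user, considered to consist of a line-of-sight component and a non-line-of-sight component with independent and identically distributed entries. The superscript $H$ is conjugate transpose, $|\cdot|$ of a matrix is the determinant, $\succeq\boldsymbol 0$ means positive semi-definite, and $(z)^+=\max(z,0)$. The unknown random azimuth angle of the target is $\theta\in[-\frac\pi2,\frac\pi2)$, and the steering vectors are $a_n(\theta)=e^{-j\pi d(N_t-2n+1)\cos\phi\sin\theta/\lambda}$ ($n=1,\dots,N_t$) and $b_m(\theta)=e^{-j\pi d(N_r-2m+1)\cos\phi\sin\theta/\lambda}$ ($m=1,\dots,N_r$), where $j$ is the imaginary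 unit, $d$ is the antenna spacing, $\lambda$ the wavelength, and $\cos\phi=\sqrt{r^2-h_B^2}/r$ with $r$ the target distance and $h_B\ge0$ the antenna height; $\dot{\boldsymbol b}(\theta)$ is the derivative of $\boldsymbol b(\theta)$. The prior density of $\theta$ is the Gaussian mixture $p_\Theta(\theta)=\sum_{k=1}^K p_k\frac{1}{\sqrt{2\pi}\sigma_k}e^{-(\theta-\theta_k)^2/(2\sigma_k^2)}$, with $K\ge1$, $p_k\in[0,1]$, $\sum_kp_k=1$, $\theta_k\in[-\frac\pi2,\frac\pi2)$, and variances $\sigma_k^2$ sufficiently small that the probability for $\theta$ to exceed $[-\frac\pi2,\frac\pi2)$ is negligible; and $\boldsymbol A_1=\int\|\dot{\boldsymbol b}(\theta)\|^2\boldsymbol a(\theta)\boldsymbol a^H(\theta)p_\Theta(\theta)\,d\theta\in\mathbb C^{N_t\times N_t}$. With dual variables $\beta>0$ (rate constraint) and $\mu\ge0$ (power constraint), the Lagrangian of (P4) is $\bar{\mathcal L}(\boldsymbol W,\beta,\mu)=\mathrm{tr}(\boldsymbol A_1\boldsymbol W)+\beta\left(\log_2|\boldsymbol I_{N_u}+\boldsymbol H\boldsymbol W\boldsymbol H^H/\sigma_c^2|-\bar R\right)-\mu(\mathrm{tr}(\boldsymbol W)-P)$, $\boldsymbol W\succeq\boldsymbol 0$. The dual function is $g(\beta,\mu)=\max_{\boldsymbol W\succeq\boldsymbol 0}\bar{\mathcal L}(\boldsymbol W,\beta,\mu)$, and the dual problem is $\min_{\beta>0,\mu\ge0}g(\beta,\mu)$;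 for any $\bar R\in(R_s^U,R_{\max}]$ there exist unique optimal dual variables $\beta^\star,\mu^\star$.
   Formalization: The formal theorem adds the assumption that H s_1 is nonzero (equivalently R_s^U > 0), which holds with probability one for a channel with continuously distributed NLoS entries; if H s_1 = 0, Q can be singular and Q^{-1/2} undefined. *)

(* Defs.v *)
From mathcomp Require Export all_boot all_order all_algebra.
From mathcomp Require Export complex.
From mathcomp Require Export all_classical all_reals all_analysis.

Set Implicit Arguments.
Unset Strict Implicit.
Unset Printing Implicit Defensive.

Import Order.TTheory GRing.Theory Num.Theory.
Import numFieldNormedType.Exports.

Local Open Scope classical_set_scope.
Local Open Scope ring_scope.
Local Open Scope complex_scope.
Local Open Scope sesquilinear_scope.

(* [M ^t*] is the conjugate transpose; [x%:C] embeds R into R[i].  The order on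
   [R[i]] is partial: [0 <= z] means that z is real and nonnegative. *)

Section MatrixNotions.
Variable R : realType.
Local Notation C := R[i].

Definition psdmx n (W : 'M[C]_n) : Prop :=
  W \is hermsymmx /\ forall x : 'cV[C]_n, 0 <= (x^t* *m W *m x) 0 0.

Definition posdefmx n (W : 'M[C]_n) : Prop :=
  W \is hermsymmx /\ forall x : 'cV[C]_n, x != 0 -> 0 < (x^t* *m W *m x) 0 0.

Definition unit_top_eigvec n (A : 'M[C]_n) (s : 'cV[C]_n) : Prop :=
  s^t* *m s = 1%:M /\
  exists2 a : C, A *m s = a *: s & forall b, eigenvalue A b -> b <= a.

(* Q^(-1/2) for Q positive definite, through the unitary diagonalization
   Q = S^-1 *m diag_mx (spectral_diag Q) *m S with S = spectralmx Q. *)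
Definition inv_sqrtmx n (Q : 'M[C]_n) : 'M[C]_n :=
  invmx (spectralmx Q)
    *m diag_mx (map_mx (fun x => (sqrtC x)^-1) (spectral_diag Q))
    *m spectralmx Q.

(* Reduced SVD G = U diag(h)^(1/2) V^H: the h i are the squares of the
   singular values, all of them nonzero. *)
Definition reduced_svd m n T (G : 'M[C]_(m, n)) (U : 'M[C]_(m, T))
    (h : 'I_T -> R) (V : 'M[C]_(n, T)) : Prop :=
  [/\ U^t* *m U = 1%:M, V^t* *m V = 1%:M, forall i, 0 < h i &
      G = U *m diag_mx (\row_i (Num.sqrt (h i))%:C) *m V^t*].

Definition is_max (S : set R) (m : R) : Prop := S m /\ ubound S m.

End MatrixNotions.

Section Sensing.
Variable R : realType.
Local Notation C := R[i].

(* e^(j x) *)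
Definition expj (x : R) : C := cos x +i* sin x.

Definition cos_elevation (r hB : R) : R := Num.sqrt (r ^+ 2 - hB ^+ 2) / r.

(* The antenna of 0-based index n is number n.+1 of the array. *)
Definition steering (N : nat) (d lambda cphi t : R) : 'cV[C]_N :=
  \col_(n < N)
    expj (- (pi * d * (N%:R - 2 * n.+1%:R + 1) * cphi * sin t / lambda)).

Definition dsteering (N : nat) (d lambda cphi t : R) : 'cV[C]_N :=
  \col_(n < N)
    (derive1 (fun u => complex.Re (steering N d lambda cphi u n 0)) t
     +i* derive1 (fun u => complex.Im (steering N d lambda cphi u n 0)) t).

Definition sqnorm n (v : 'cV[C]_n) : R := complex.Re ((v^t* *m v) 0 0).

Definition mixture_pdf (K : nat) (p theta sigma : 'I_K -> R) (t : R) : R :=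
  \sum_(k < K) p k * normal_pdf (theta k) (sigma k) t.

Definition Cintegral (f : R -> C) : C :=
  (\int[lebesgue_measure]_(t in setT) complex.Re (f t))
  +i* (\int[lebesgue_measure]_(t in setT) complex.Im (f t)).

Definition A1mx (Nt Nr : nat) (d lambda cphi : R) (pdf : R -> R) : 'M[C]_Nt :=
  let a := steering Nt d lambda cphi in
  let db := dsteering Nr d lambda cphi in
  \matrix_(i < Nt, j < Nt)
    Cintegral (fun t =>
      ((sqnorm (db t) * pdf t)%:C *: (a t *m (a t)^t*)) i j).

End Sensing.

Section ProblemP4.
Variable R : realType.
Local Notation C := R[i].
Variables (Nt Nu : nat) (A1 : 'M[C]_Nt) (H : 'M[C]_(Nu, Nt)).
Variables (sigmac P Rbar : R).

Definition log2 (x : R) : R := ln x / ln 2.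

(* For the Hermitian W considered, the determinants and traces below are real;
   [complex.Re] only changes their type. *)
Definition rate (W : 'M[C]_Nt) : R :=
  log2 (complex.Re
    (\det (1%:M + ((sigmac ^+ 2)^-1)%:C *: (H *m W *m H^t*)))).

Definition objective (W : 'M[C]_Nt) : R := complex.Re (\tr (A1 *m W)).

Definition P4_feasible (W : 'M[C]_Nt) : Prop :=
  [/\ Rbar <= rate W, complex.Re (\tr W) <= P & psdmx W].

Definition P4_optimal (W : 'M[C]_Nt) : Prop :=
  P4_feasible W /\ forall W', P4_feasible W' -> objective W' <= objective W.

Definition lagrangian (beta mu : R) (W : 'M[C]_Nt) : R :=
  objective W + beta * (rate W - Rbar) - mu * (complex.Re (\tr W) - P).

(* The dual function takes the value +oo where the Lagrangian is unbounded. *)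
Definition dual_fun (beta mu : R) : \bar R :=
  ereal_sup [set (lagrangian beta mu W)%:E | W in @psdmx R Nt].

Definition dual_optimal (beta mu : R) : Prop :=
  [/\ 0 < beta, 0 <= mu &
      forall beta' mu', 0 < beta' -> 0 <= mu' ->
        (dual_fun beta mu <= dual_fun beta' mu')%E].

Definition rate_sensing (s : 'cV[C]_Nt) : R := rate (P%:C *: (s *m s^t*)).

Definition achievable_rates : set R :=
  [set rate W | W in [set W | psdmx W /\ complex.Re (\tr W) <= P]].

Definition Qmx (beta mu : R) : 'M[C]_Nt :=
  (mu / beta)%:C%:M - (beta^-1)%:C *: A1.

Definition waterfilling T (h : 'I_T -> R) : 'M[C]_T :=
  diag_mx (\row_i (Num.max ((ln 2)^-1 - sigmac ^+ 2 / h i) 0)%:C).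

Definition W_U (beta mu : R) T (h : 'I_T -> R) (V : 'M[C]_(Nt, T)) :
    'M[C]_Nt :=
  let S := inv_sqrtmx (Qmx beta mu) in
  S *m V *m waterfilling h *m V^t* *m S.

End ProblemP4.

(* Main.v *)
(* A dual point with finite dual value must have Q > 0: testing the Lagrangian
   on t s1 s1^H, whose rate grows like ln t because H s1 <> 0, forces
   lambda_max(A1) < mu.  In the coordinates Z = Q^(1/2) W Q^(1/2) the Lagrangian
   is, up to constants, beta (log2 det(1 + Gamma^(1/2) V^H Z V Gamma^(1/2) /
   sigma^2) - tr Z).  Weak duality for ln det (ln det M <= tr M - n, with
   equality only at M = 1) shows that water-filling is its unique maximizer.
   Primal feasibility and complementary slackness of that maximizer come from the
   minimality of (beta, mu): perturbing the water-filling certificate bounds the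
   dual function above at nearby points, with slopes rate(W_U) - Rbar in beta and
   P - tr W_U in mu and an error of second order, so these slopes satisfy the
   first-order conditions. *)

Require Import Defs.
From mathcomp Require Import ring lra.

Set Implicit Arguments.
Unset Strict Implicit.
Unset Printing Implicit Defensive.

Import Order.TTheory GRing.Theory Num.Theory.
Import numFieldNormedType.Exports.

Local Open Scope classical_set_scope.
Local Open Scope ring_scope.
Local Open Scope complex_scope.
Local Open Scope sesquilinear_scope.

(** * Hermitian matrices *)

Section PositiveMatrices.
Variable R : realType.
Local Notation C := R[i].

Definition rtr n (A : 'M[C]_n) : R := complex.Re (\tr A).

Definition rdiag n (f : 'I_n -> R) : 'M[C]_n := diag_mx (\row_i (f i)%:C).

(** * Real parts, real traces, adjoints and real diagonal matrices *)

Lemma Re_add (x y : C) : complex.Re (x + y) = complex.Re x + complex.Re y.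
Proof. by case: x; case: y. Qed.

Lemma Re_opp (x : C) : complex.Re (- x) = - complex.Re x.
Proof. by case: x. Qed.

Lemma Re_mulr (a : R) (x : C) : complex.Re (a%:C * x) = a * complex.Re x.
Proof. by case: x => u v /=; rewrite mul0r subr0. Qed.

Lemma Re_conj (x : C) : complex.Re (x^*)%R = complex.Re x.
Proof. by case: x. Qed.

Lemma Re_sum (I : Type) (s : seq I) (P : pred I) (F : I -> C) :
  complex.Re (\sum_(i <- s | P i) F i) = \sum_(i <- s | P i) complex.Re (F i).
Proof. by apply: (big_morph _ Re_add). Qed.

Lemma ge0_Re (x : C) : 0 <= x -> 0 <= complex.Re x.
Proof. by rewrite lecE => /andP[]. Qed.

Lemma ge0_ReK (x : C) : 0 <= x -> (complex.Re x)%:C = x.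
Proof. by move=> x0; apply: RRe_real; apply: ger0_real. Qed.

Lemma rtrD n (A B : 'M[C]_n) : rtr (A + B) = rtr A + rtr B.
Proof. by rewrite /rtr linearD /= Re_add. Qed.

Lemma rtrN n (A : 'M[C]_n) : rtr (- A) = - rtr A.
Proof. by rewrite /rtr linearN /= Re_opp. Qed.

Lemma rtrB n (A B : 'M[C]_n) : rtr (A - B) = rtr A - rtr B.
Proof. by rewrite rtrD rtrN. Qed.

Lemma rtrZ n (a : R) (A : 'M[C]_n) : rtr (a%:C *: A) = a * rtr A.
Proof. by rewrite /rtr linearZ /= Re_mulr. Qed.

Lemma rtrC m n (A : 'M[C]_(m, n)) (B : 'M[C]_(n, m)) :
  rtr (A *m B) = rtr (B *m A).
Proof. by rewrite /rtr mxtrace_mulC. Qed.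

Lemma rtr1 n : rtr (1%:M : 'M[C]_n) = n%:R.
Proof. by rewrite /rtr mxtrace1 -(rmorph_nat (real_complex R)). Qed.

Lemma rtr_diag n (f : 'I_n -> R) : rtr (rdiag f) = \sum_i f i.
Proof.
rewrite /rtr mxtrace_diag Re_sum; apply: eq_bigr => i _; by rewrite mxE.
Qed.

Lemma adjmxM m n p (A : 'M[C]_(m, n)) (B : 'M[C]_(n, p)) :
  (A *m B)^t* = B^t* *m A^t*.
Proof. by rewrite trmx_mul map_mxM. Qed.

Lemma adjmxD m n (A B : 'M[C]_(m, n)) : (A + B)^t* = A^t* + B^t*.
Proof. by rewrite linearD /= map_mxD. Qed.

Lemma adjmxN m n (A : 'M[C]_(m, n)) : (- A)^t* = - A^t*.
Proof. by rewrite linearN /= map_mxN. Qed.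

Lemma adjmxB m n (A B : 'M[C]_(m, n)) : (A - B)^t* = A^t* - B^t*.
Proof. by rewrite adjmxD adjmxN. Qed.

Lemma adjmxZ m n (a : R) (A : 'M[C]_(m, n)) :
  (a%:C *: A)^t* = a%:C *: A^t*.
Proof.
rewrite linearZ /= map_mxZ; congr (_ *: _); exact: conjc_real.
Qed.

Lemma adjmx1 n : (1%:M : 'M[C]_n)^t* = 1%:M.
Proof. by rewrite trmx1 map_mx1. Qed.

Lemma adjmx_rdiag n (f : 'I_n -> R) : (rdiag f)^t* = rdiag f.
Proof.
rewrite /rdiag tr_diag_mx map_diag_mx; congr diag_mx.
by apply/rowP => i; rewrite !mxE; apply: conjc_real.
Qed.

Lemma rdiagM n (f g : 'I_n -> R) :
  rdiag f *m rdiag g = rdiag (fun i => f i * g i).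
Proof.
rewrite /rdiag mulmx_diag; congr diag_mx.
by apply/rowP => i; rewrite !mxE -rmorphM.
Qed.

Lemma rdiagD n (f g : 'I_n -> R) :
  rdiag f + rdiag g = rdiag (fun i => f i + g i).
Proof.
rewrite /rdiag -linearD; congr diag_mx.
by apply/rowP => i; rewrite !mxE -rmorphD.
Qed.

Lemma rdiagZ n a (f : 'I_n -> R) :
  a%:C *: rdiag f = rdiag (fun i => a * f i).
Proof.
rewrite /rdiag -linearZ; congr diag_mx.
by apply/rowP => i; rewrite !mxE -rmorphM.
Qed.

Lemma rdiagB n (f g : 'I_n -> R) :
  rdiag f - rdiag g = rdiag (fun i => f i - g i).
Proof.
rewrite /rdiag -linearB; congr diag_mx.
by apply/rowP => i; rewrite !mxE -rmorphB.
Qed.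

Lemma rdiag_const n a : rdiag (fun _ : 'I_n => a) = a%:C%:M.
Proof.
rewrite -diag_const_mx; congr diag_mx.
by apply/rowP => i; rewrite !mxE.
Qed.

Lemma rdiag1 n : rdiag (fun _ : 'I_n => 1) = 1%:M.
Proof. exact: rdiag_const. Qed.

Lemma eq_rdiag n (f g : 'I_n -> R) : f =1 g -> rdiag f = rdiag g.
Proof. by move=> fg; congr diag_mx; apply/rowP => i; rewrite !mxE fg. Qed.

Lemma rdiag_sqrtK n (f : 'I_n -> R) : (forall i, 0 <= f i) ->
  rdiag (fun i => Num.sqrt (f i)) *m rdiag (fun i => Num.sqrt (f i)) = rdiag f.
Proof.
by move=> f0; rewrite rdiagM; apply: eq_rdiag => i; rewrite -expr2 sqr_sqrtr.
Qed.

(** * Unitary diagonalization of Hermitian matrices *)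

Lemma hermsymP n (A : 'M[C]_n) : reflect (A^t* = A) (A \is hermsymmx).
Proof.
by rewrite is_hermitianmxE expr0 scale1r eq_sym; exact: eqP.
Qed.

(** Eigenvalues of a Hermitian matrix are real, so passing to real parts in [spectral_diag] loses
    nothing and the spectrum lives in [R]. *)
Lemma herm_spectral n (A : 'M[C]_n) : A^t* = A ->
  let S := spectralmx A in
  let f i := complex.Re (spectral_diag A 0 i) in
  [/\ S *m S^t* = 1%:M, S^t* *m S = 1%:M, invmx S = S^t* &
      A = S^t* *m rdiag f *m S].
Proof.
move=> /hermsymP hA S f.
have uS : S \is unitarymx by apply: spectral_unitarymx.
have iS : invmx S = S^t* by apply: invmx_unitary.
have dE : rdiag f = diag_mx (spectral_diag A).
  congr diag_mx; apply/rowP => i; rewrite !mxE.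
  apply: RRe_real; exact: (mxOverP (hermitian_spectral_diag_real hA)).
split=> //; first exact/unitarymxP.
  by rewrite -iS mulVmx // unitarymx_unit.
by rewrite dE -iS; apply/orthomx_spectralP/hermitian_normalmx.
Qed.

Lemma herm_diag n (A : 'M[C]_n) : A^t* = A ->
  exists (S : 'M[C]_n) (f : 'I_n -> R),
    [/\ S *m S^t* = 1%:M, S^t* *m S = 1%:M & A = S^t* *m rdiag f *m S].
Proof.
move=> /herm_spectral; set f := fun i => _ => -[SS SS' _ AE].
by exists (spectralmx A), f.
Qed.

(** * Positive semidefinite matrices *)

Lemma qformE m n (A : 'M[C]_(m, n)) (x : 'cV[C]_n) :
  (x^t* *m (A^t* *m A) *m x) 0 0 = \sum_i `|(A *m x) i 0| ^+ 2.
Proof.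
rewrite !mulmxA -mulmxA -adjmxM mxE; apply: eq_bigr => i _.
by rewrite !mxE mulrC normCK.
Qed.

Lemma psdmx_adjmul m n (A : 'M[C]_(m, n)) : psdmx (A^t* *m A).
Proof.
split; first by apply/hermsymP; rewrite adjmxM trmxCK.
by move=> x; rewrite qformE sumr_ge0 // => i _; rewrite exprn_ge0.
Qed.

Lemma psdmx_herm n (A : 'M[C]_n) : psdmx A -> A^t* = A.
Proof. by case=> /hermsymP. Qed.

Lemma psdmx_congr m n (A : 'M[C]_(m, n)) (W : 'M[C]_m) :
  psdmx W -> psdmx (A^t* *m W *m A).
Proof.
move=> [/hermsymP hW pW]; split.
  by apply/hermsymP; rewrite !adjmxM trmxCK hW mulmxA.
by move=> x; have := pW (A *m x); rewrite adjmxM !mulmxA.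
Qed.

Lemma psdmxD n (A B : 'M[C]_n) : psdmx A -> psdmx B -> psdmx (A + B).
Proof.
move=> [/hermsymP hA pA] [/hermsymP hB pB]; split.
  by apply/hermsymP; rewrite adjmxD hA hB.
by move=> x; rewrite mulmxDr mulmxDl mxE addr_ge0.
Qed.

Lemma psdmxZ n (a : R) (A : 'M[C]_n) : 0 <= a -> psdmx A -> psdmx (a%:C *: A).
Proof.
move=> a0 [/hermsymP hA pA]; split.
  by apply/hermsymP; rewrite adjmxZ hA.
by move=> x; rewrite -scalemxAr -scalemxAl mxE mulr_ge0 // ler0c.
Qed.

Lemma psdmx_rdiag n (f : 'I_n -> R) : (forall i, 0 <= f i) -> psdmx (rdiag f).
Proof.
move=> f0; suff -> : rdiag f =
    (rdiag (fun i => Num.sqrt (f i)))^t* *m rdiag (fun i => Num.sqrt (f i)).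
  exact: psdmx_adjmul.
by rewrite adjmx_rdiag rdiag_sqrtK.
Qed.

Lemma psdmx1 n : psdmx (1%:M : 'M[C]_n).
Proof. by rewrite -rdiag1; apply: psdmx_rdiag. Qed.

Lemma qform_delta n (A : 'M[C]_n) i :
  ((delta_mx i 0 : 'cV[C]_n)^t* *m A *m (delta_mx i 0 : 'cV[C]_n)) 0 0 = A i i.
Proof.
have -> : (delta_mx i 0 : 'cV[C]_n)^t* = delta_mx 0 i.
  by rewrite trmx_delta; apply/matrixP => a b; rewrite !mxE; exact: conjC_nat.
by rewrite -rowE -colE !mxE.
Qed.

Lemma psdmx_diag_ge0 n (A : 'M[C]_n) i : psdmx A -> 0 <= A i i.
Proof. by move=> [_ /(_ (delta_mx i 0))]; rewrite qform_delta. Qed.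

Lemma psdmx_rtr_ge0 n (A : 'M[C]_n) : psdmx A -> 0 <= rtr A.
Proof.
move=> pA; apply: ge0_Re; apply: sumr_ge0 => i _; exact: psdmx_diag_ge0.
Qed.

Lemma spectral_psd n (A : 'M[C]_n) : psdmx A ->
  forall i, 0 <= complex.Re (spectral_diag A 0 i).
Proof.
move=> pA i; have [SS _ _ AE] := herm_spectral (psdmx_herm pA).
have := psdmx_congr ((spectralmx A)^t*) pA.
rewrite {2}AE trmxCK !mulmxA SS mul1mx -mulmxA SS mulmx1.
by move=> /psdmx_diag_ge0 -/(_ i) /ge0_Re; rewrite !mxE eqxx.
Qed.

(** The factor is the square root of the spectrum times the diagonalizing unitary; it turns traces
    against [W] into Frobenius norms or congruences. *)
Lemma psdmx_factor n (W : 'M[C]_n) :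
  psdmx W -> exists A : 'M[C]_n, W = A^t* *m A.
Proof.
move=> pW; have [_ _ _ WE] := herm_spectral (psdmx_herm pW).
have := spectral_psd pW.
set f := fun i => _ in WE * => f0.
exists (rdiag (fun i => Num.sqrt (f i)) *m spectralmx W).
rewrite adjmxM adjmx_rdiag !mulmxA -[_ *m rdiag _ *m rdiag _]mulmxA.
by rewrite rdiag_sqrtK.
Qed.

(** With A = D^H D, cyclicity turns the trace into that of the psd matrix D B D^H. *)
Lemma psdmx_rtrM_ge0 n (A B : 'M[C]_n) :
  psdmx A -> psdmx B -> 0 <= rtr (A *m B).
Proof.
move=> /psdmx_factor[D ->] pB; rewrite -mulmxA rtrC -mulmxA.
have := psdmx_rtr_ge0 (psdmx_congr (D^t*) pB).
by rewrite trmxCK -mulmxA.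
Qed.

(** The trace is the squared Frobenius norm, a sum of nonnegative terms. *)
Lemma rtr_adjmul_eq0 m n (A : 'M[C]_(m, n)) : rtr (A^t* *m A) = 0 -> A = 0.
Proof.
move=> t0; apply/matrixP => i j; rewrite mxE.
have nn k l : 0 <= complex.Re ((A^t*) k l * A l k).
  by rewrite !mxE; apply: ge0_Re; rewrite mulrC -normCK exprn_ge0.
move: t0; rewrite /rtr /mxtrace Re_sum => /eqP.
rewrite psumr_eq0; last first.
  by move=> k _; rewrite mxE Re_sum sumr_ge0.
move=> /allP/(_ j (mem_index_enum _)) /=; rewrite mxE Re_sum.
rewrite psumr_eq0 // => /allP/(_ i (mem_index_enum _)) /=; rewrite !mxE.
rewrite mulrC -normCK => /eqP r0; apply/eqP; rewrite -normr_eq0 -sqrf_eq0.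
by rewrite -[_ ^+ 2]ge0_ReK ?exprn_ge0 // r0.
Qed.

(** Writing W = A^H A, the trace is the squared Frobenius norm of A B. *)
Lemma psdmx_mul_eq0 m n (W : 'M[C]_n) (B : 'M[C]_(n, m)) :
  psdmx W -> rtr (B^t* *m W *m B) = 0 -> W *m B = 0.
Proof.
move=> /psdmx_factor[A ->]; rewrite !mulmxA -mulmxA -adjmxM.
by move=> /rtr_adjmul_eq0 AB; rewrite -mulmxA AB mulmx0.
Qed.

Lemma herm_bound n (B : 'M[C]_n) : B^t* = B ->
  exists b : R, [/\ 0 <= b, psdmx (b%:C *: 1%:M + B) & psdmx (b%:C *: 1%:M - B)].
Proof.
move=> hB; have [S [f [_ SS BE]]] := herm_diag hB.
(* The sum of the absolute eigenvalues dominates each of them. *)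
pose b := \sum_i `|f i|.
have bf i : `|f i| <= b.
  by rewrite /b (bigD1 i) //= lerDl sumr_ge0.
have bE : b%:C *: 1%:M = S^t* *m rdiag (fun _ => b) *m S.
  by rewrite rdiag_const mul_mx_scalar -scalemxAl SS.
exists b; split; first exact: sumr_ge0.
- rewrite bE BE -mulmxDl -mulmxDr rdiagD; apply/psdmx_congr/psdmx_rdiag.
  by move=> i; have := bf i; rewrite ler_norml => /andP[]; lra.
- have -> : b%:C *: 1%:M - B = S^t* *m rdiag (fun i => b - f i) *m S.
    by rewrite bE BE -mulmxBl -mulmxBr rdiagB.
  apply/psdmx_congr/psdmx_rdiag.
  by move=> i; have := bf i; rewrite ler_norml => /andP[]; lra.
Qed.

(** * Positive definite matrices *)

Lemma posdefmx_diag n (S : 'M[C]_n) (f : 'I_n -> R) :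
  S *m S^t* = 1%:M -> S^t* *m S = 1%:M ->
  posdefmx (S^t* *m rdiag f *m S) <-> forall i, 0 < f i.
Proof.
move=> SS SS'; split=> [[_ pM] i|f0].
  (* This is the i-th eigenvector, where the quadratic form takes the value [f i]. *)
  have nz : S^t* *m (delta_mx i 0 : 'cV[C]_n) != 0.
    apply/eqP => /(congr1 (mulmx S)); rewrite mulmxA SS mul1mx mulmx0.
    by move=> /matrixP/(_ i 0)/eqP; rewrite !mxE !eqxx oner_eq0.
  have := pM _ nz; rewrite adjmxM trmxCK !mulmxA -(mulmxA _ S) SS mulmx1.
  rewrite -(mulmxA _ S) SS mulmx1 qform_delta !mxE eqxx mulr1n ltcE.
  by move=> /andP[].
pose g i := Num.sqrt (f i).
have ME : S^t* *m rdiag f *m S = (rdiag g *m S)^t* *m (rdiag g *m S).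
  rewrite adjmxM adjmx_rdiag !mulmxA -[_ *m rdiag _ *m rdiag _]mulmxA.
  by rewrite rdiag_sqrtK // => i; rewrite ltW.
have [hM _] := psdmx_adjmul (rdiag g *m S); rewrite ME; split=> // x x0.
rewrite qformE lt_def sumr_ge0 ?andbT; last by move=> i _; rewrite exprn_ge0.
apply: contra x0; rewrite psumr_eq0; last by move=> i _; rewrite exprn_ge0.
move=> /allP z; suff Sx0 : S *m x = 0.
  by rewrite -[x]mul1mx -SS' -mulmxA Sx0 mulmx0.
apply/matrixP => i j; rewrite ord1 [RHS]mxE; apply/eqP.
have := z i (mem_index_enum _); rewrite /= sqrf_eq0 normr_eq0 -mulmxA.
rewrite /rdiag mul_diag_mx mxE mulf_eq0 mxE => /orP[|//].
by rewrite -(rmorph0 (real_complex R)) (inj_eq (@complexI R)) sqrtr_eq0 leNgt f0.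
Qed.

Lemma psd_posdefD n (A B : 'M[C]_n) : psdmx A -> posdefmx B -> posdefmx (A + B).
Proof.
move=> [/hermsymP hA pA] [/hermsymP hB pB]; split.
  by apply/hermsymP; rewrite adjmxD hA hB.
by move=> x x0; rewrite mulmxDr mulmxDl mxE ltr_wpDl // pB.
Qed.

Lemma posdefmx1 n : posdefmx (1%:M : 'M[C]_n).
Proof.
have [h p] := psdmx1 n; split=> // x x0.
rewrite lt_def p andbT; apply: contra x0.
rewrite -[1%:M]mulmx1 -{1}adjmx1 qformE psumr_eq0; last first.
  by move=> i _; rewrite exprn_ge0.
move=> /allP z; apply/eqP/matrixP => i j; rewrite ord1 mxE; apply/eqP.
by have := z i (mem_index_enum _); rewrite /= sqrf_eq0 normr_eq0 mul1mx.
Qed.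

Lemma posdefmx_congr m n (A : 'M[C]_(m, n)) (B : 'M[C]_(n, m)) (W : 'M[C]_m) :
  B *m A = 1%:M -> posdefmx W -> posdefmx (A^t* *m W *m A).
Proof.
move=> BA [/hermsymP hW pW]; split.
  by apply/hermsymP; rewrite !adjmxM trmxCK hW mulmxA.
move=> x x0; have nz : A *m x != 0.
  by apply: contra x0 => /eqP Ax; rewrite -[x]mul1mx -BA -mulmxA Ax mulmx0.
by have := pW _ nz; rewrite adjmxM !mulmxA.
Qed.

Lemma posdefmx_psd n (A : 'M[C]_n) : posdefmx A -> psdmx A.
Proof.
move=> [hA pA]; split=> // x; have [->|x0] := eqVneq x 0.
  by rewrite mulmx0 mxE.
exact/ltW/pA.
Qed.

End PositiveMatrices.

(** * Determinants and logarithms *)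

Section LogDet.
Variable R : realType.
Local Notation C := R[i].

(** Sylvester's determinant identity, from two block triangular factorizations of one block
    matrix. *)
Lemma det_add1C m n (A : 'M[C]_(m, n)) (B : 'M[C]_(n, m)) :
  \det (1%:M + A *m B) = \det (1%:M + B *m A).
Proof.
have e1 : block_mx 1%:M (- A) B 1%:M =
    block_mx 1%:M 0 B 1%:M *m block_mx 1%:M (- A) 0 (1%:M + B *m A).
  rewrite mulmx_block !mulmx1 !mul1mx !mul0mx !addr0 mulmxN.
  by rewrite addrC addrK.
have e2 : block_mx 1%:M (- A) B 1%:M =
    block_mx 1%:M (- A) 0 1%:M *m block_mx (1%:M + A *m B) 0 B 1%:M.
  rewrite mulmx_block !mulmx1 !mul1mx !mul0mx !add0r.
  by rewrite mulNmx addrK.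
have := congr1 determinant e1; rewrite {1}e2 !det_mulmx !det_ublock !det_lblock.
by rewrite !det1 !mul1r !mulr1.
Qed.

Lemma det_congr n (A B M : 'M[C]_n) : \det (A *m M *m B) = \det (B *m A) * \det M.
Proof. by rewrite !det_mulmx mulrAC [\det A * _]mulrC. Qed.

(** * Logarithm inequalities, for scalars and for determinants *)

Lemma ln_le_sub1 (x : R) : 0 < x -> ln x <= x - 1.
Proof.
by move=> x0; have := expR_ge1Dx (ln x); rewrite lnK ?posrE //; lra.
Qed.

Lemma ln_eq_sub1 (x : R) : 0 < x -> ln x = x - 1 -> x = 1.
Proof.
move=> x0 e; apply: contra_eq e => x1.
have /expR_gt1Dx : ln x != 0 by rewrite ln_eq0.
by rewrite lnK ?posrE // => h; apply/eqP; lra.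
Qed.

Lemma ln_prod n (f : 'I_n -> R) : (forall i, 0 < f i) ->
  ln (\prod_i f i) = \sum_i ln (f i).
Proof.
move=> f0; suff [] : ln (\prod_i f i) = \sum_i ln (f i) /\ 0 < \prod_i f i by [].
elim/big_ind2 : _ => [|x a y b [<- a0] [<- b0]|//]; first by rewrite ln1.
by rewrite lnM ?mulr_gt0.
Qed.

Lemma det_rdiag n (f : 'I_n -> R) : \det (rdiag f) = (\prod_i f i)%:C.
Proof.
rewrite det_diag rmorph_prod; apply: eq_bigr => i _; by rewrite mxE.
Qed.

Lemma det_diagonalized n (S : 'M[C]_n) (f : 'I_n -> R) :
  S *m S^t* = 1%:M -> \det (S^t* *m rdiag f *m S) = (\prod_i f i)%:C.
Proof.
move=> SS; rewrite !det_mulmx mulrAC -det_mulmx -det_rdiag.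
by rewrite det_mulmx [_ * \det S]mulrC -det_mulmx SS det1 mul1r.
Qed.

Lemma rtr_diagonalized n (S : 'M[C]_n) (f : 'I_n -> R) :
  S *m S^t* = 1%:M -> rtr (S^t* *m rdiag f *m S) = \sum_i f i.
Proof. by move=> SS; rewrite rtrC mulmxA SS mul1mx rtr_diag. Qed.

Lemma posdefmx_det n (M : 'M[C]_n) : posdefmx M ->
  0 < complex.Re (\det M) /\ \det M = (complex.Re (\det M))%:C.
Proof.
move=> pM; have [S [f [SS SS' ME]]] := herm_diag (psdmx_herm (posdefmx_psd pM)).
rewrite ME det_diagonalized //; split=> //=; apply: prodr_gt0 => i _.
by move: i; apply/(posdefmx_diag f SS SS'); rewrite -ME.
Qed.

(** The scalar bound ln x <= x - 1, summed over the eigenvalues. *)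
Lemma lndet_le n (M : 'M[C]_n) : posdefmx M ->
  ln (complex.Re (\det M)) <= rtr M - n%:R.
Proof.
move=> pM; have [S [f [SS SS' ME]]] := herm_diag (psdmx_herm (posdefmx_psd pM)).
have f0 : forall i, 0 < f i by apply/(posdefmx_diag f SS SS'); rewrite -ME.
rewrite ME det_diagonalized // rtr_diagonalized //= ln_prod //.
have -> : \sum_i f i - n%:R = \sum_i (f i - 1).
  by rewrite sumrB sumr_const card_ord.
by apply: ler_sum => i _; exact: ln_le_sub1.
Qed.

(** Equality in the sum forces equality at each eigenvalue, so all of them are 1. *)
Lemma lndet_eq n (M : 'M[C]_n) : posdefmx M ->
  ln (complex.Re (\det M)) = rtr M - n%:R -> M = 1%:M.
Proof.
move=> pM; have [S [f [SS SS' ME]]] := herm_diag (psdmx_herm (posdefmx_psd pM)).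
have f0 : forall i, 0 < f i by apply/(posdefmx_diag f SS SS'); rewrite -ME.
rewrite {1 2}ME det_diagonalized // rtr_diagonalized //= ln_prod // => e.
have /eqP : \sum_i (f i - 1 - ln (f i)) = 0.
  by rewrite !sumrB sumr_const card_ord e; lra.
rewrite psumr_eq0 => [/allP z|i _]; last by rewrite subr_ge0 ln_le_sub1.
have f1 i : f i = 1.
  apply: ln_eq_sub1 => //; apply/esym/eqP; rewrite -subr_eq0.
  exact: (z i (mem_index_enum _)).
by rewrite ME (eq_rdiag f1) rdiag1 mulmx1.
Qed.

(** This is [lndet_le] for the matrix a M; the factor [a] is a free dual variable, tuned in
    [wf_opt_scale]. *)
Lemma lndet_scale_le n (a : R) (M : 'M[C]_n) : 0 < a -> posdefmx M ->
  ln (complex.Re (\det M)) <= a * rtr M - n%:R - n%:R * ln a.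
Proof.
move=> a0 pM.
have pM' : posdefmx (a%:C *: M).
  have [/hermsymP hM p] := pM; split.
    by apply/hermsymP; rewrite adjmxZ hM.
  move=> x /p xp; rewrite -scalemxAr -scalemxAl mxE.
  by rewrite mulr_gt0 // -(rmorph0 (real_complex R)) ltcR.
have [d0 dE] := posdefmx_det pM.
have := lndet_le pM'; rewrite rtrZ detZ dE -rmorphXn -rmorphM /=.
rewrite lnM ?posrE ?exprn_gt0 // lnXn // -mulr_natl; lra.
Qed.

(* Weak duality for [ln det] at the dual point [1 + E]: moving the dual point by
   [E] only costs a term of second order. *)
Lemma lndet_perturb_le n (M E : 'M[C]_n) : posdefmx M -> E^t* = E ->
  rtr (E *m E) <= 4^-1 ->
  ln (complex.Re (\det M)) <= rtr ((1%:M + E) *m (M - 1%:M)) + 2 * rtr (E *m E).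
Proof.
move=> pM hE; have [S [e [SS SS' EE]]] := herm_diag hE.
have E2 : rtr (E *m E) = \sum_i e i ^+ 2.
  rewrite EE -!mulmxA (mulmxA S) SS mul1mx (mulmxA (rdiag e)) rdiagM mulmxA.
  by rewrite rtr_diagonalized //; apply: eq_bigr => i _; rewrite expr2.
rewrite E2 => small.
(* The bound on tr E^2, the sum of the squared eigenvalues, confines each eigenvalue to
   [-1/2, 1/2]. *)
have e1 i : - 2^-1 <= e i <= 2^-1.
  have : e i ^+ 2 <= 4^-1.
    apply: le_trans small; rewrite (bigD1 i) //= lerDl sumr_ge0 // => j _.
    exact: sqr_ge0.
  by move=> ?; apply/andP; split; nra.
have p1 i : 0 < 1 + e i by have /andP[] := e1 i; lra.
pose D := rdiag (fun i => Num.sqrt (1 + e i)).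
have DD : D *m D = rdiag (fun i => 1 + e i).
  by rewrite rdiag_sqrtK // => i; exact: ltW.
pose D' := rdiag (fun i => (Num.sqrt (1 + e i))^-1).
have D'D : D' *m D = 1%:M.
  rewrite rdiagM -rdiag1; apply: eq_rdiag => i; rewrite mulVf //.
  by rewrite gt_eqF // sqrtr_gt0.
(* A A^H = 1 + E, so congruence by [A] multiplies the determinant by det (1 + E) and turns the trace
   into tr ((1 + E) M). *)
pose A := S^t* *m D.
have pM2 : posdefmx (A^t* *m M *m A).
  apply: (@posdefmx_congr _ _ _ _ (D' *m S)) => //.
  by rewrite mulmxA -(mulmxA _ S) SS mulmx1.
have E1 : 1%:M + E = S^t* *m rdiag (fun i => 1 + e i) *m S.
  by rewrite -rdiagD rdiag1 mulmxDr mulmxDl mulmx1 SS' -EE.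
have AA : A *m A^t* = 1%:M + E.
  by rewrite adjmxM trmxCK adjmx_rdiag mulmxA -(mulmxA _ D D) DD E1.
have tr2 : rtr (A^t* *m M *m A) = rtr ((1%:M + E) *m M).
  by rewrite -mulmxA [LHS]rtrC -mulmxA AA rtrC.
have [d0 dE] := posdefmx_det pM.
have det2 : complex.Re (\det (A^t* *m M *m A)) =
    (\prod_i (1 + e i)) * complex.Re (\det M).
  by rewrite det_congr AA E1 det_diagonalized // Re_mulr.
have := lndet_le pM2; rewrite det2 tr2 lnM ?posrE //; last exact: prodr_gt0.
have trE : rtr (1%:M + E) = n%:R + \sum_i e i.
  by rewrite rtrD rtr1 EE rtr_diagonalized.
rewrite ln_prod // mulmxBr mulmx1 rtrB trE.
(* Termwise, - ln (1 + e) <= (1 + e)^-1 - 1 = - e + e^2 / (1 + e), and 1 + e >= 1/2 gives the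
   constant 2. *)
suff : - \sum_i ln (1 + e i) <= - (\sum_i e i) + 2 * (\sum_i e i ^+ 2) by lra.
rewrite -!sumrN mulr_sumr -big_split /=; apply: ler_sum => i _.
have q := p1 i; have /andP[l u] := e1 i.
rewrite -lnV ?posrE //; apply: le_trans (ln_le_sub1 _) _; first by rewrite invr_gt0.
rewrite -(ler_pM2r q) mulrBl mulVf ?gt_eqF //.
nra.
Qed.

End LogDet.

(** * The water-filling problem *)

Section Waterfilling.
Variable R : realType.
Local Notation C := R[i].
Variables (n T : nat) (sigmac : R) (h : 'I_T -> R) (V : 'M[C]_(n, T)).
Hypotheses (sigmac_gt0 : 0 < sigmac) (h_gt0 : forall i, 0 < h i).
Hypothesis VV : V^t* *m V = 1%:M.

Local Notation c := (sigmac ^+ 2).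
Local Notation l := (ln 2 : R).

Definition wf_power i : R := Num.max (l^-1 - c / h i) 0.
(* The optimal Gram matrix is [diag wf_det], and [1 - V (diag wf_coef) V^*] is
   the multiplier of the constraint [0 <= Z]. *)
Definition wf_det i : R := 1 + h i * wf_power i / c.
Definition wf_coef i : R := h i / (c * l * wf_det i).

Local Notation v := wf_power.
Local Notation d := wf_det.
Local Notation k := wf_coef.

Let c_gt0 : 0 < c. Proof. by rewrite exprn_gt0. Qed.
Let l_gt0 : 0 < l. Proof. by rewrite ln_gt0 // ltr1n. Qed.

Lemma wf_power_ge0 i : 0 <= v i.
Proof. by rewrite le_max lexx orbT. Qed.

Lemma wf_det_gt0 i : 0 < d i.
Proof. by rewrite ltr_pwDl // divr_ge0 ?mulr_ge0 ?wf_power_ge0 // ltW. Qed.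

Lemma wf_coef_gt0 i : 0 < k i.
Proof. by rewrite divr_gt0 ?h_gt0 // !mulr_gt0 // wf_det_gt0. Qed.

Lemma wf_detMcoef i : l * (d i * k i) = h i / c.
Proof.
have := wf_det_gt0 i; rewrite /wf_coef => d0; field.
by rewrite !gt_eqF.
Qed.

(** The dichotomy of water-filling: a channel with positive power has [wf_det] equal to h / (c l),
    hence [wf_coef] equal to 1; a channel below the water level has no power and h / (c l) <= 1. *)
Lemma wf_cases i : (k i = 1) \/ (v i = 0 /\ k i <= 1).
Proof.
have h0 := h_gt0 i; rewrite /wf_coef /wf_det /wf_power.
case: (leP (l^-1 - c / h i) 0) => [le0|gt0]; [right|left].
  split=> //; rewrite mulr0 mul0r addr0 mulr1 ler_pdivrMr ?mulr_gt0 // mul1r.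
  have := ler_wpM2r (ltW (mulr_gt0 h0 l_gt0)) le0; rewrite mul0r.
  have -> : (l^-1 - c / h i) * (h i * l) = h i - c * l.
    by field; rewrite !gt_eqF.
  by rewrite subr_le0.
field.
by rewrite !gt_eqF //= ?mulr_gt0.
Qed.

Lemma wf_coef_le1 i : k i <= 1.
Proof. by have [->|[]] := wf_cases i. Qed.

(** Complementary slackness between the power and the multiplier 1 - k. *)
Lemma wf_coefMpower i : k i * v i = v i.
Proof. by have [->|[-> _]] := wf_cases i; rewrite ?mul1r ?mulr0. Qed.

(** * The compressed Gram matrix and its normalization at the optimum *)

Definition wf_opt : 'M[C]_n := V *m rdiag v *m V^t*.

(** When H Q^(-1/2) has the reduced SVD with data [h] and [V], and Z = Q^(1/2) W Q^(1/2),
    Sylvester's identity gives this matrix the determinant of I + H W H^H / sigma^2. *)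
Definition gram (Z : 'M[C]_n) : 'M[C]_T :=
  1%:M + (c^-1)%:C *: (rdiag (fun i => Num.sqrt (h i)) *m
    (V^t* *m Z *m V) *m rdiag (fun i => Num.sqrt (h i))).

Definition lngram (Z : 'M[C]_n) : R := ln (complex.Re (\det (gram Z))).

(* [diag wf_det ^ (-1/2) * gram Z * diag wf_det ^ (-1/2)], see [gramE]. *)
Definition ngram (Z : 'M[C]_n) : 'M[C]_T :=
  1%:M + l%:C *: (rdiag (fun i => Num.sqrt (k i)) *m
    (V^t* *m Z *m V - rdiag v) *m rdiag (fun i => Num.sqrt (k i))).

Local Notation slack := (1%:M - V *m rdiag k *m V^t*).

Lemma gram_posdef Z : psdmx Z -> posdefmx (gram Z).
Proof.
move=> pZ; rewrite /gram addrC; apply: psd_posdefD; last exact: posdefmx1.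
apply: psdmxZ; first by rewrite invr_ge0 ltW.
rewrite -{1}adjmx_rdiag; do 2 apply: psdmx_congr.
exact: pZ.
Qed.

Lemma gramE Z : gram Z =
  rdiag (fun i => Num.sqrt (d i)) *m ngram Z *m rdiag (fun i => Num.sqrt (d i)).
Proof.
rewrite /gram /ngram mulmxDr mulmxDl mulmx1 rdiag_sqrtK; last first.
  by move=> i; rewrite ltW // wf_det_gt0.
(* Since d k = h / (c l), the product of the square roots of [d] and [k] is [q] times that of
   [h]. *)
pose q := Num.sqrt (c * l)^-1.
have cl0 : 0 < c * l by rewrite mulr_gt0.
have qq : l * (q * q) = c^-1.
  rewrite -expr2 sqr_sqrtr ?invr_ge0 ?(ltW cl0) //; field.
  by rewrite !gt_eqF.
have dk i : Num.sqrt (d i) * Num.sqrt (k i) = q * Num.sqrt (h i).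
  rewrite -!sqrtrM ?invr_ge0 ?(ltW cl0) ?(ltW (wf_det_gt0 i)) //.
  congr Num.sqrt; have := wf_detMcoef i; move: (d i * k i) => x xE.
  by apply: (mulfI (lt0r_neq0 l_gt0)); rewrite xE; field; rewrite !gt_eqF.
have DK : rdiag (fun i => Num.sqrt (d i)) *m rdiag (fun i => Num.sqrt (k i))
    = q%:C *: rdiag (fun i => Num.sqrt (h i)).
  by rewrite rdiagM rdiagZ; apply: eq_rdiag.
have KD : rdiag (fun i => Num.sqrt (k i)) *m rdiag (fun i => Num.sqrt (d i))
    = q%:C *: rdiag (fun i => Num.sqrt (h i)).
  by rewrite rdiagM rdiagZ; apply: eq_rdiag => i; rewrite mulrC.
rewrite -scalemxAr -scalemxAl !mulmxA DK -!mulmxA KD -!scalemxAl -!scalemxAr.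
rewrite !scalerA -!rmorphM /= -mulrA qq mulmxBl mulmxBr scalerBr !mulmxA.
rewrite !rdiagM rdiagZ [RHS]addrCA [LHS]addrC; congr (_ + _).
rewrite -rdiag1 rdiagB; apply: eq_rdiag => i.
rewrite mulrAC -expr2 sqr_sqrtr ?(ltW (h_gt0 i)) // /wf_det; ring.
Qed.

Lemma ngram_posdef Z : psdmx Z -> posdefmx (ngram Z).
Proof.
move=> /gram_posdef; rewrite gramE => pG.
pose D := rdiag (fun i => Num.sqrt (d i)).
pose D' := rdiag (fun i => (Num.sqrt (d i))^-1).
have DD' : D *m D' = 1%:M.
  rewrite rdiagM -rdiag1; apply: eq_rdiag => i; rewrite mulfV //.
  by rewrite gt_eqF // sqrtr_gt0 wf_det_gt0.
have D'D : D' *m D = 1%:M.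
  rewrite rdiagM -rdiag1; apply: eq_rdiag => i; rewrite mulVf //.
  by rewrite gt_eqF // sqrtr_gt0 wf_det_gt0.
have := posdefmx_congr DD' pG; rewrite adjmx_rdiag -/D.
by rewrite -!mulmxA DD' mulmx1 mulmxA D'D mul1mx.
Qed.

Lemma lngramE Z : psdmx Z ->
  lngram Z = \sum_i ln (d i) + ln (complex.Re (\det (ngram Z))).
Proof.
move=> pZ; have [d0 _] := posdefmx_det (ngram_posdef pZ).
have dd i : 0 < d i by exact: wf_det_gt0.
rewrite /lngram gramE det_congr rdiag_sqrtK; last by move=> i; exact: ltW.
rewrite det_rdiag Re_mulr lnM ?posrE //; last exact: prodr_gt0.
by rewrite ln_prod.
Qed.

Lemma wf_opt_compress : V^t* *m wf_opt *m V = rdiag v.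
Proof. by rewrite /wf_opt !mulmxA VV mul1mx -mulmxA VV mulmx1. Qed.

Lemma wf_opt_psd : psdmx wf_opt.
Proof.
rewrite /wf_opt -{1}[V]trmxCK; apply/psdmx_congr/psdmx_rdiag.
exact: wf_power_ge0.
Qed.

Lemma ngram_opt : ngram wf_opt = 1%:M.
Proof.
by rewrite /ngram wf_opt_compress subrr mulmx0 mul0mx scaler0 addr0.
Qed.

Lemma lngram_opt : lngram wf_opt = \sum_i ln (d i).
Proof.
by rewrite lngramE ?ngram_opt ?det1 /= ?ln1 ?addr0 //; exact: wf_opt_psd.
Qed.

Lemma rtr_ngram Z : rtr (ngram Z - 1%:M) =
  l * rtr (rdiag k *m (V^t* *m Z *m V - rdiag v)).
Proof.
rewrite /ngram addrAC subrr add0r rtrZ -mulmxA rtrC -mulmxA rdiag_sqrtK.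
  by rewrite [in RHS]rtrC.
by move=> i; rewrite ltW // wf_coef_gt0.
Qed.

Lemma rtr_slack Z :
  rtr (slack *m Z) = rtr Z - rtr (rdiag k *m (V^t* *m Z *m V)).
Proof.
by rewrite mulmxBl mul1mx rtrB -!mulmxA [rtr (V *m _)]rtrC -!mulmxA.
Qed.

(** An exact optimality gap: the defect in [lndet_le] at [ngram Z], plus the multiplier paired with
    [Z]. The linear terms cancel because k v = v. *)
Lemma lngram_gapE Z : psdmx Z ->
  lngram Z - l * rtr Z - (lngram wf_opt - l * rtr wf_opt) =
  ln (complex.Re (\det (ngram Z))) - rtr (ngram Z - 1%:M)
    - l * rtr (slack *m Z).
Proof.
move=> pZ; rewrite lngram_opt lngramE // rtr_ngram rtr_slack mulmxBr rtrB.
have -> : rtr wf_opt = rtr (rdiag k *m rdiag v).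
  rewrite /wf_opt rtrC mulmxA VV mul1mx rdiagM; congr rtr; apply: eq_rdiag => i.
  by rewrite wf_coefMpower.
ring.
Qed.

(** * The multiplier matrix and unique optimality of water-filling *)

Lemma proj_compl_psd : psdmx (1%:M - V *m V^t*).
Proof.
have e : 1%:M - V *m V^t* = (1%:M - V *m V^t*)^t* *m (1%:M - V *m V^t*).
  rewrite adjmxB adjmx1 adjmxM trmxCK mulmxBr mulmx1 mulmxBl mul1mx.
  by rewrite !mulmxA -(mulmxA V) VV mulmx1 subrr subr0.
by rewrite e; apply: psdmx_adjmul.
Qed.

Lemma compress_psd (f : 'I_T -> R) : (forall i, 0 <= f i) ->
  psdmx (V *m rdiag f *m V^t*).
Proof. by move=> f0; rewrite -{1}[V]trmxCK; apply/psdmx_congr/psdmx_rdiag. Qed.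

(** Separates the directions outside the column space of [V] from those inside it, where the weights
    are 1 - k; both pieces are psd. *)
Lemma slack_splitE :
  slack = (1%:M - V *m V^t*) + V *m rdiag (fun i => 1 - k i) *m V^t*.
Proof.
by rewrite -rdiagB rdiag1 mulmxBr mulmxBl mulmx1 addrA subrK.
Qed.

Lemma slack_rest_psd : psdmx (V *m rdiag (fun i => 1 - k i) *m V^t*).
Proof. by apply: compress_psd => i; rewrite subr_ge0 wf_coef_le1. Qed.

Lemma slack_psd : psdmx slack.
Proof.
rewrite slack_splitE; exact: psdmxD proj_compl_psd slack_rest_psd.
Qed.

Lemma wf_opt_max Z : psdmx Z ->
  lngram Z - l * rtr Z <= lngram wf_opt - l * rtr wf_opt.
Proof.
move=> pZ; rewrite -subr_le0 lngram_gapE // rtrB rtr1.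
have := lndet_le (ngram_posdef pZ).
have := psdmx_rtrM_ge0 slack_psd pZ; move: (rtr (_ *m _)) => s s0.
have : 0 <= l * s by rewrite mulr_ge0 // ltW.
lra.
Qed.

(** Both nonpositive parts of the gap vanish: [ngram Z] equal to 1 fixes the compression V^H Z V,
    and zero slack kills [Z] outside the column space of [V]. *)
Lemma wf_opt_uniq Z : psdmx Z ->
  lngram Z - l * rtr Z = lngram wf_opt - l * rtr wf_opt -> Z = wf_opt.
Proof.
move=> pZ /eqP; rewrite -subr_eq0 lngram_gapE // rtrB rtr1 => /eqP e.
have le := lndet_le (ngram_posdef pZ).
have s0 := psdmx_rtrM_ge0 slack_psd pZ.
have ls0 : 0 <= l * rtr (slack *m Z) by rewrite mulr_ge0 // ltW.
have M1 : ngram Z = 1%:M by apply: lndet_eq (ngram_posdef pZ) _; lra.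
have {ls0} ls0 : l * rtr (slack *m Z) = 0 by lra.
have {}s0 : rtr (slack *m Z) = 0.
  by move/eqP: ls0; rewrite mulf_eq0 gt_eqF //= => /eqP.
have p0 : rtr ((1%:M - V *m V^t*) *m Z) = 0.
  have := psdmx_rtrM_ge0 proj_compl_psd pZ.
  have := psdmx_rtrM_ge0 slack_rest_psd pZ.
  move: s0; rewrite slack_splitE mulmxDl rtrD => /eqP s0 r0 p0.
  by move: s0; rewrite paddr_eq0 // => /andP[/eqP].
(* All [wf_coef] are positive, so the scaling by their square roots in [ngram] can be undone. *)
have XE : V^t* *m Z *m V = rdiag v.
  pose Ki := rdiag (fun i => (Num.sqrt (k i))^-1).
  pose Ks := rdiag (fun i => Num.sqrt (k i)).
  have KK : Ks *m Ki = 1%:M.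
    rewrite rdiagM -rdiag1; apply: eq_rdiag => i; rewrite mulfV //.
    by rewrite gt_eqF // sqrtr_gt0 wf_coef_gt0.
  have KK' : Ki *m Ks = 1%:M.
    rewrite rdiagM -rdiag1; apply: eq_rdiag => i; rewrite mulVf //.
    by rewrite gt_eqF // sqrtr_gt0 wf_coef_gt0.
  move/eqP: M1; rewrite -subr_eq0 /ngram addrAC subrr add0r scaler_eq0.
  rewrite -(rmorph0 (real_complex R)) (inj_eq (@complexI R)) gt_eqF //=.
  move=> /eqP/(congr1 (fun A => Ki *m A *m Ki)).
  rewrite -/Ks mulmx0 mul0mx -!mulmxA KK mulmx1 mulmxA KK' mul1mx.
  by move=> /eqP; rewrite !mulmxA subr_eq0 => /eqP.
have Z0 : Z *m (1%:M - V *m V^t*) = 0.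
  apply: psdmx_mul_eq0 => //; rewrite -mulmxA rtrC -mulmxA.
  have [/hermsymP hP _] := proj_compl_psd; rewrite hP.
  suff -> : (1%:M - V *m V^t*) *m (1%:M - V *m V^t*) = 1%:M - V *m V^t*.
    by rewrite rtrC.
  rewrite mulmxBr mulmx1 mulmxBl mul1mx.
  by rewrite !mulmxA -(mulmxA V) VV mulmx1 subrr subr0.
have ZV : Z = Z *m V *m V^t*.
  by move/eqP: Z0; rewrite mulmxBr mulmx1 subr_eq0 mulmxA => /eqP.
have VZ : Z = V *m V^t* *m Z.
  by rewrite -{1}(psdmx_herm pZ) {1}ZV !adjmxM trmxCK (psdmx_herm pZ) mulmxA.
by rewrite /wf_opt -XE {1}ZV {1}VZ !mulmxA.
Qed.

(** * Second-order stability of the water-filling bound *)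

(** The factor (1 + e)^-1 in [lndet_scale_le] matches the weight 1 + e on ln det; with ln (1 + e) <=
    e the first-order terms cancel and T e^2 remains. *)
Lemma wf_opt_scale Z (e : R) : psdmx Z -> -1 < e ->
  (1 + e) * lngram Z - l * rtr Z <=
  lngram wf_opt - l * rtr wf_opt + e * lngram wf_opt + T%:R * e ^+ 2.
Proof.
move=> pZ e1; have := lngram_gapE pZ; rewrite rtrB rtr1.
have s0 : 0 <= l * rtr (slack *m Z).
  by apply: mulr_ge0 (ltW l_gt0) (psdmx_rtrM_ge0 slack_psd pZ).
have a0 : 0 < 1 + e by lra.
have := @lndet_scale_le _ _ (1 + e)^-1 _ _ (ngram_posdef pZ).
rewrite invr_gt0 => /(_ a0); rewrite lnV ?posrE //.
have := lngramE pZ; rewrite lngram_opt.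
set D := ln (complex.Re _); set m := rtr (ngram Z); set s := \sum_i _.
move=> -> Dle gap.
have le : (1 + e) * D <= m - (1 + e) * T%:R + (1 + e) * (T%:R * ln (1 + e)).
  have := ler_wpM2l (ltW a0) Dle; rewrite !mulrBr mulVKf ?gt_eqF //.
  by rewrite !mulrN opprK.
have : (1 + e) * (T%:R * ln (1 + e)) <= (1 + e) * (T%:R * e).
  rewrite ler_wpM2l ?(ltW a0) // ler_wpM2l //.
  by have := ln_le_sub1 a0; lra.
nra.
Qed.

Lemma rtr_lincombM p q (x y z w : R) (X1 Y1 : 'M[C]_(p, q)) (X2 Y2 : 'M[C]_(q, p))
    (Z : 'M[C]_p) :
  rtr ((x%:C *: X1 + y%:C *: Y1) *m (z%:C *: X2 + w%:C *: Y2) *m Z) =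
  x * z * rtr (X1 *m X2 *m Z) + x * w * rtr (X1 *m Y2 *m Z) +
  (y * z * rtr (Y1 *m X2 *m Z) + y * w * rtr (Y1 *m Y2 *m Z)).
Proof.
rewrite (mulmxDl (x%:C *: X1)) (mulmxDr (x%:C *: X1)) (mulmxDr (y%:C *: Y1)).
rewrite (mulmxDl (_ + _) (_ + _)) (mulmxDl (x%:C *: X1 *m _)).
rewrite (mulmxDl (y%:C *: Y1 *m _)).
rewrite -!scalemxAl -!scalemxAr -!scalemxAl !scalerA.
rewrite -(rmorphM _ x z) -(rmorphM _ x w) -(rmorphM _ y z) -(rmorphM _ y w).
apply: etrans (rtrD _ _) _; congr (_ + _); apply: etrans (rtrD _ _) _;
  by congr (_ + _); apply: rtrZ.
Qed.

Local Notation comp := (V *m rdiag k *m V^t*).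

(* First-order sensitivity of the optimal slack: up to [O(t^2)], replacing the
   unit weight of the trace by [1 + t B] moves the certificate [V K V^*] to
   [V (K + t K V^* B V K) V^*]. *)
Lemma slack_perturb (B : 'M[C]_n) : B^t* = B ->
  exists g eta : R, [/\ 0 <= g, 0 < eta &
    forall (t : R) (Z : 'M[C]_n), `|t| <= eta -> psdmx Z ->
    0 <= rtr (slack *m Z) + t * (rtr (B *m Z) - rtr (comp *m B *m comp *m Z))
         + g * t ^+ 2 * rtr (V *m V^t* *m Z)].
Proof.
move=> hB; have [b [/= b0 pbD pbB]] := herm_bound hB.
have hBB : (2%:C *: (B *m B))^t* = 2%:C *: (B *m B).
  by rewrite adjmxZ adjmxM hB.
have [g [g0 _ pg]] := herm_bound hBB.
(* The radius ensures |t| b <= 1/2, hence 1/2 + t B is psd; [g] dominates 2 B^2. *)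
exists g, (2 + 2 * b)^-1; split=> //; first by rewrite invr_gt0; lra.
move=> t Z tb pZ; set N := comp.
have tb1 : `|t| * b <= 2^-1.
  have : `|t| * (2 + 2 * b) <= 1 by rewrite -ler_pdivlMr ?mul1r //; lra.
  by have := normr_ge0 t; lra.
have hN : N^t* = N.
  by rewrite /N !adjmxM trmxCK adjmx_rdiag mulmxA.
have NN : N *m N = V *m rdiag (fun i => k i * k i) *m V^t*.
  by rewrite -rdiagM /N !mulmxA -(mulmxA _ (V^t*)) VV mulmx1.
have p1 : psdmx (N - N *m N).
  rewrite NN -mulmxBl -mulmxBr rdiagB; apply: compress_psd => i.
  by have := wf_coef_le1 i; have := wf_coef_gt0 i; nra.
have p2 : psdmx (V *m V^t* - N *m N).
  rewrite NN -{1}[V]mulmx1 -rdiag1 -mulmxBl -mulmxBr rdiagB.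
  apply: compress_psd => i.
  by have := wf_coef_le1 i; have := wf_coef_gt0 i; nra.
clearbody N.
pose D := 1%:M - N.
have hD : D^t* = D by rewrite adjmxB adjmx1 hN.
(* With D = 1 - N, B - N B N = D B D + D B N + N B D and D - D^2 = N - N^2. So the matrix paired
   with [Z] is (N - N^2) + 2 A^H A + D (1/2 + t B) D + t^2 N (g - 2 B^2) N + g t^2 (V V^H - N^2), a
   sum of psd matrices. *)
pose A := (2^-1)%:C *: D + t%:C *: (B *m N).
have p3 := psdmx_adjmul A.
have pt : psdmx ((2^-1)%:C *: 1%:M + t%:C *: B).
  have [t0|t0] := leP 0 t.
    have -> : (2^-1)%:C *: 1%:M + t%:C *: B =
        (2^-1 - t * b)%:C *: 1%:M + t%:C *: (b%:C *: 1%:M + B).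
      rewrite scalerDr scalerA addrA -scalerDl -rmorphM -rmorphD /=.
      by rewrite subrK.
    have a0 : 0 <= 2^-1 - t * b by move: tb1; rewrite ger0_norm // subr_ge0.
    exact: psdmxD (psdmxZ a0 (psdmx1 _ _)) (psdmxZ t0 pbD).
  have -> : (2^-1)%:C *: 1%:M + t%:C *: B =
      (2^-1 + t * b)%:C *: 1%:M + (- t)%:C *: (b%:C *: 1%:M - B).
    rewrite scalerBr scalerA addrA -scalerDl -rmorphM -rmorphD /=.
    by rewrite mulNr addrK rmorphN scaleNr opprK.
  have a0 : 0 <= 2^-1 + t * b.
    by move: tb1; rewrite ltr0_norm // mulNr -subr_ge0 opprK.
  have t1 : 0 <= - t by rewrite oppr_ge0 ltW.
  exact: psdmxD (psdmxZ a0 (psdmx1 _ _)) (psdmxZ t1 pbB).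
have p4 := psdmx_congr D pt.
have p5 := psdmx_congr N pg.
pose r (X : 'M[C]_n) := rtr (X *m Z).
have rD X Y : r (X + Y) = r X + r Y by rewrite /r mulmxDl rtrD.
have rN X : r (- X) = - r X by rewrite /r mulNmx rtrN.
have rZ a X : r (a%:C *: X) = a * r X by rewrite /r -scalemxAl rtrZ.
have r_ge0 X : psdmx X -> 0 <= r X by move=> pX; apply: psdmx_rtrM_ge0.
have rB X Y : r (X - Y) = r X - r Y by rewrite rD rN.
have hA : A^t* = (2^-1)%:C *: D + t%:C *: (N *m B).
  by rewrite /A adjmxD !adjmxZ adjmxM hB hN hD.
have DN X : D *m X = X - N *m X by rewrite /D mulmxBl mul1mx.
have ND X : X *m D = X - X *m N by rewrite /D mulmxBr mulmx1.
have rDef : r D = r 1%:M - r N by rewrite /D rB.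
clearbody D.
have := r_ge0 _ p3; rewrite {1}/r hA /A rtr_lincombM -!/(r _).
rewrite !DN !ND !rB -!mulmxA -rDef => {}p3.
have := r_ge0 _ p4; rewrite hD.
have -> : D *m ((2^-1)%:C *: 1%:M + t%:C *: B) *m D =
    (2^-1)%:C *: (D *m D) + t%:C *: (D *m B *m D).
  by rewrite mulmxDr mulmxDl -!scalemxAr -!scalemxAl mulmx1.
rewrite rD !rZ !DN !ND mulmxBl !rB -!mulmxA => {}p4.
have := r_ge0 _ p5; rewrite hN.
have -> : N *m (g%:C *: 1%:M - 2%:C *: (B *m B)) *m N =
    g%:C *: (N *m N) - 2%:C *: (N *m (B *m B) *m N).
  by rewrite mulmxBr mulmxBl -!scalemxAr -!scalemxAl mulmx1.
rewrite rB !rZ -!mulmxA => {}p5.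
have := r_ge0 _ p2; rewrite rB => {}p2.
have := r_ge0 _ p1; rewrite rB => {}p1.
rewrite -!/(r _).
have gt0 : 0 <= g * t ^+ 2 by rewrite mulr_ge0 // sqr_ge0.
have q5 := mulr_ge0 (sqr_ge0 t) p5.
have q2 := mulr_ge0 gt0 p2.
move: p1 q2 p3 p4 q5; move: (r D) (r N) (r (N *m N)) (r B) (r (B *m N)).
move: (r (N *m B)) (r (N *m (B *m N))) (r (N *m (B *m (B *m N)))).
move: (r (V *m V^t*)) => ? ? ? ? ? ? ? ? ?; clear => *; lra.
Qed.

(** Combines the moved multiplier of [slack_perturb] with the moved dual point of
    [lndet_perturb_le]; the point 1 + E is chosen so that the terms in N B N and V V^H cancel. *)
Lemma wf_opt_perturb (B : 'M[C]_n) : B^t* = B ->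
  exists g eta : R, [/\ 0 <= g, 0 < eta &
    forall (t : R) (Z : 'M[C]_n), `|t| <= eta -> psdmx Z ->
    lngram Z - l * rtr Z - l * t * rtr (B *m Z) <=
    lngram wf_opt - l * rtr wf_opt - l * t * rtr (B *m wf_opt) + g * t ^+ 2].
Proof.
move=> hB; have [g [eta [g0 eta0 pert]]] := slack_perturb hB.
set N := comp in pert.
pose B' := V^t* *m B *m V.
have hB' : B'^t* = B' by rewrite /B' !adjmxM trmxCK hB mulmxA.
(* At the optimum [N] acts as the identity, because k v = v. *)
have BZ0 : rtr (B *m wf_opt) = rtr (rdiag k *m B' *m rdiag k *m rdiag v).
  rewrite -[in RHS]mulmxA rdiagM -[in RHS]mulmxA [RHS]rtrC -[in RHS]mulmxA rdiagM.
  have -> : rdiag (fun i => k i * v i * k i) = rdiag v :> 'M[C]_T.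
    by apply: eq_rdiag => i; rewrite wf_coefMpower mulrC wf_coefMpower.
  by rewrite /wf_opt mulmxA [LHS]rtrC !mulmxA.
have NZ Z : rtr (N *m B *m N *m Z) =
    rtr (rdiag k *m B' *m rdiag k *m (V^t* *m Z *m V)).
  by rewrite /N /B' -!mulmxA [LHS]rtrC !mulmxA.
have VZ Z : rtr (V *m V^t* *m Z) = rtr (V^t* *m Z *m V).
  by rewrite -mulmxA [LHS]rtrC.
have NE : comp = N by [].
clearbody N B'.
pose Ks := rdiag (fun i => Num.sqrt (k i)) : 'M[C]_T.
(* The inverse of diag k: it undoes the scaling in [ngram], so pairing with it yields the trace of
   V^H Z V. *)
pose E2 := rdiag (fun i => (k i)^-1) : 'M[C]_T.
have KK : Ks *m Ks = rdiag k.
  by rewrite rdiag_sqrtK // => i; rewrite ltW // wf_coef_gt0.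
have KE : Ks *m E2 *m Ks = 1%:M.
  rewrite !rdiagM -rdiag1; apply: eq_rdiag => i.
  rewrite mulrAC -expr2 sqr_sqrtr ?mulfV //; last by rewrite ltW // wf_coef_gt0.
  by rewrite gt_eqF // wf_coef_gt0.
have hKs : Ks^t* = Ks by exact: adjmx_rdiag.
have hE2 : E2^t* = E2 by exact: adjmx_rdiag.
have ngramB Z : ngram Z - 1%:M =
    l%:C *: (Ks *m (V^t* *m Z *m V - rdiag v) *m Ks).
  by rewrite /ngram addrAC subrr add0r.
clearbody Ks E2.
pose E1 := Ks *m B' *m Ks.
have hE1 : E1^t* = E1 by rewrite /E1 !adjmxM hB' hKs mulmxA.
have E1M Z : rtr (E1 *m (ngram Z - 1%:M)) =
    l * (rtr (N *m B *m N *m Z) - rtr (B *m wf_opt)).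
  rewrite ngramB -scalemxAr rtrZ NZ BZ0 -rtrB -mulmxBr; congr (_ * _).
  by rewrite -KK /E1 !mulmxA [LHS]rtrC !mulmxA.
have E2M Z : rtr (E2 *m (ngram Z - 1%:M)) =
    l * (rtr (V *m V^t* *m Z) - rtr (rdiag v : 'M[C]_T)).
  rewrite ngramB -scalemxAr rtrZ VZ -rtrB; congr (_ * _).
  by rewrite mulmxA [LHS]rtrC !mulmxA KE mul1mx.
clearbody E1.
have [e11 e11E] : {x : R | rtr (E1 *m E1) = x} by eexists.
have [e12 e12E] : {x : R | rtr (E1 *m E2) = x} by eexists.
have e21E : rtr (E2 *m E1) = e12 by rewrite rtrC.
have [e22 e22E] : {x : R | rtr (E2 *m E2) = x} by eexists.
(* Bounds tr E^2 by e3 t^2 as soon as |t| <= 1. *)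
pose e3 : R := `|e11| + 2 * g * `|e12| + g ^+ 2 * `|e22|.
have e30 : 0 <= e3 by rewrite /e3 !addr_ge0 // ?mulr_ge0 // ?sqr_ge0.
pose xv := rtr (rdiag v : 'M[C]_T).
pose lam := l * g * `|xv|.
have lam0 : 0 <= lam by rewrite /lam !mulr_ge0 // ltW.
(* The second bound on |t| gives both |t| <= 1 and e3 t^2 <= 1/4, the smallness required of E. *)
exists (2 * e3 + lam), (Num.min eta (1 + 4 * e3)^-1); split.
- by lra.
- by rewrite lt_min eta0 invr_gt0; lra.
move=> t Z; rewrite le_min => /andP[teta te3] pZ.
have {}pert := pert t Z teta pZ.
pose E := t%:C *: E1 + (- (g * t ^+ 2))%:C *: E2.
have hE : E^t* = E by rewrite /E adjmxD !adjmxZ hE1 hE2.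
have EE : rtr (E *m E) =
    t ^+ 2 * (e11 - 2 * g * (t * e12) + g ^+ 2 * (t ^+ 2 * e22)).
  rewrite -[E *m E]mulmx1 rtr_lincombM !mulmx1 e11E e12E e21E e22E.
  ring.
have t4 : `|t| * (1 + 4 * e3) <= 1.
  by rewrite -ler_pdivlMr ?mul1r //; lra.
have t0 := normr_ge0 t.
have t1 : `|t| <= 1 by nra.
have tt : t ^+ 2 = `|t| ^+ 2 by rewrite real_normK ?num_real.
have EEle : rtr (E *m E) <= t ^+ 2 * e3.
  rewrite EE ler_wpM2l ?sqr_ge0 // /e3.
  apply: lerD; first apply: lerD; first exact: ler_norm.
    rewrite -mulrN ler_wpM2l ?mulr_ge0 //.
    by rewrite (le_trans (ler_norm _)) // normrN normrM ler_piMl.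
  rewrite ler_wpM2l ?sqr_ge0 // (le_trans (ler_norm _)) // normrM ler_piMl //.
  by rewrite ger0_norm ?sqr_ge0 // tt exprn_ile1.
have small : rtr (E *m E) <= 4^-1.
  apply: (le_trans EEle); rewrite tt; clear -t4 t0 t1 e30; nra.
have := lndet_perturb_le (ngram_posdef pZ) hE small.
have := lngram_gapE pZ.
have EM : rtr ((1%:M + E) *m (ngram Z - 1%:M)) = rtr (ngram Z - 1%:M)
    + (t * (l * (rtr (N *m B *m N *m Z) - rtr (B *m wf_opt)))
       - g * t ^+ 2 * (l * (rtr (V *m V^t* *m Z) - xv))).
  rewrite (mulmxDl 1%:M) mul1mx (rtrD (ngram Z - 1%:M)); congr (_ + _).
  rewrite /E (mulmxDl (t%:C *: _)) -!scalemxAl rtrD -E2M -E1M.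
  by congr (_ + _); [|rewrite -[RHS]mulNr]; apply: rtrZ.
rewrite EM NE.
have xvle : xv <= `|xv| := ler_norm xv.
have q1 := mulr_ge0 (ltW l_gt0) pert.
have q2 : 0 <= l * g * t ^+ 2 * (`|xv| - xv).
  have lg0 := mulr_ge0 (ltW l_gt0) g0.
  by apply: mulr_ge0 (mulr_ge0 lg0 (sqr_ge0 t)) _; rewrite subr_ge0.
rewrite -/xv /lam.
move: q1 q2 EEle.
set F := lngram Z; set F0 := lngram wf_opt; set Dm := ln (complex.Re _).
set EEr := rtr (E *m E); set m1 := rtr (ngram Z - _).
set s := rtr ((1%:M - N) *m Z).
set bz := rtr (B *m Z); set bz0 := rtr (B *m wf_opt).
set nz := rtr (N *m B *m N *m Z).
set x := rtr (V *m V^t* *m Z); set z := rtr Z; set z0 := rtr wf_opt.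
move: F F0 Dm EEr m1 s bz bz0 nz x z z0 => F F0 Dm EEr m1 s bz bz0 nz x z z0.
move: (`|xv|) => axv q1 q2 q3 q4 q5.
lra.
Qed.

End Waterfilling.

(** * The Lagrangian dual *)

Section Duality.
Variable R : realType.
Local Notation C := R[i].

Lemma inv_sqrtmxP n (Q : 'M[C]_n) : posdefmx Q ->
  exists S : 'M[C]_n, [/\ S^t* = S, S *m S = Q, S *m inv_sqrtmx Q = 1%:M &
    inv_sqrtmx Q *m S = 1%:M].
Proof.
move=> pQ; have hQ := psdmx_herm (posdefmx_psd pQ).
have [] := herm_spectral hQ; set P := spectralmx Q; set f := fun i => _.
move=> PP PP' iP QE.
have f0 : forall i, 0 < f i.
  by apply/(posdefmx_diag f PP PP'); rewrite -QE.
pose s i : R := Num.sqrt (f i).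
have s0 i : 0 < s i by rewrite sqrtr_gt0.
have sdE i : spectral_diag Q 0 i = (f i)%:C.
  apply/esym/RRe_real.
  by apply: (mxOverP (hermitian_spectral_diag_real _)); apply/hermsymP.
have dE : map_mx (fun x => (sqrtC x)^-1) (spectral_diag Q) =
    \row_i ((s i)^-1)%:C.
  apply/rowP => i; rewrite !mxE fmorphV; congr (_^-1).
  have -> : spectral_diag Q 0 i = (s i)%:C ^+ 2.
    by rewrite sdE -rmorphXn sqr_sqrtr // ltW.
  by rewrite sqrCK // ler0c ltW.
have SE : inv_sqrtmx Q = P^t* *m rdiag (fun i => (s i)^-1) *m P.
  by rewrite /inv_sqrtmx -/P iP dE.
have ss i : s i * s i = f i by rewrite -expr2 sqr_sqrtr // ltW.
clear sdE dE iP f0 pQ; clearbody s f P; rewrite SE.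
have fold g1 g2 : P^t* *m rdiag g1 *m P *m (P^t* *m rdiag g2 *m P) =
    P^t* *m rdiag (fun i => g1 i * g2 i) *m P.
  by rewrite -rdiagM !mulmxA -(mulmxA _ P) PP mulmx1.
have fold1 g : (forall i, g i = 1) -> P^t* *m rdiag g *m P = 1%:M.
  by move=> g1; rewrite (eq_rdiag g1) rdiag1 mulmx1.
exists (P^t* *m rdiag s *m P); split.
- by rewrite !adjmxM adjmx_rdiag trmxCK mulmxA.
- by rewrite fold (eq_rdiag ss) -QE.
- by rewrite fold fold1 // => i; rewrite mulfV // gt_eqF.
- by rewrite fold fold1 // => i; rewrite mulVf // gt_eqF.
Qed.

Lemma first_order_ge0 (a g eta : R) : 0 < eta -> 0 <= g ->
  (forall e, 0 < e <= eta -> 0 <= e * a + g * e ^+ 2) -> 0 <= a.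
Proof.
move=> eta0 g0 le; rewrite leNgt; apply/negP => a0.
(* Small enough that g e <= - a / 2, which makes e (a + g e) negative. *)
pose e := Num.min eta (- a / (2 * (g + 1))).
have g1 : 0 < 2 * (g + 1) by lra.
have e0 : 0 < e by rewrite lt_min eta0 divr_gt0 // oppr_gt0.
have e1 : e <= eta by rewrite ge_min lexx.
have e2 : e * (2 * (g + 1)) <= - a.
  by rewrite -ler_pdivlMr // ge_min lexx orbT.
have := le e; rewrite e0 e1 => /(_ isT).
have : e * a + g * e ^+ 2 = e * (a + g * e) by ring.
move=> ->; rewrite pmulr_rge0 //; nra.
Qed.

(** Scalar bookkeeping: [r], [z], [t] stand for the rate, tr (Q W) and tr W, with index 0 at the
    candidate and 1 at a competitor; the objective is mu t - beta z. *)
Lemma lagrangian_beta_step (beta mu e g r0 r1 z0 z1 t0 t1 P Rbar : R) :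
  0 < beta -> (1 + e) * r1 - z1 <= r0 - z0 + e * r0 + g * e ^+ 2 ->
  mu * t1 - beta * z1 + beta * (1 + e) * (r1 - Rbar) - mu * (t1 - P) <=
  mu * t0 - beta * z0 + beta * (r0 - Rbar) - mu * (t0 - P)
    + beta * (e * (r0 - Rbar) + g * e ^+ 2).
Proof.
move=> b0 le; rewrite -subr_ge0 in le; rewrite -subr_ge0.
have := mulr_ge0 (ltW b0) le; congr (0 <= _); ring.
Qed.

Lemma lagrangian_mu_step (beta mu t g r0 r1 z0 z1 t0 t1 P Rbar : R) :
  0 < beta -> r1 - z1 - t * t1 <= r0 - z0 - t * t0 + g * t ^+ 2 ->
  mu * t1 - beta * z1 + beta * (r1 - Rbar) - (mu + beta * t) * (t1 - P) <=
  mu * t0 - beta * z0 + beta * (r0 - Rbar) - mu * (t0 - P)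
    + beta * (t * (P - t0) + g * t ^+ 2).
Proof.
move=> b0 le; rewrite -subr_ge0 in le; rewrite -subr_ge0.
have := mulr_ge0 (ltW b0) le; congr (0 <= _); ring.
Qed.

(** * Consequences of dual optimality *)

Section Problem.
Variables (n m : nat) (A : 'M[C]_n) (H : 'M[C]_(m, n)).
Variables (sigmac P Rbar beta mu : R).
Hypotheses (sigmac_gt0 : 0 < sigmac) (hA : A^t* = A).
Hypothesis dual_opt : dual_optimal A H sigmac P Rbar beta mu.

Local Notation c := (sigmac ^+ 2).
Local Notation l := (ln 2 : R).
Let c_gt0 : 0 < c. Proof. by rewrite exprn_gt0. Qed.
Let l_gt0 : 0 < l. Proof. by rewrite ln_gt0 // ltr1n. Qed.

Let beta_gt0 : 0 < beta. Proof. by case: dual_opt. Qed.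
Let mu_ge0 : 0 <= mu. Proof. by case: dual_opt. Qed.

Local Notation Lag := (lagrangian A H sigmac P Rbar).

(** Lets minimality be tested by upper bounds at other dual points, without evaluating the dual
    function. *)
Lemma dual_optimal_ub beta' mu' b : 0 < beta' -> 0 <= mu' ->
  (forall W, psdmx W -> Lag beta' mu' W <= b) ->
  forall W, psdmx W -> Lag beta mu W <= b.
Proof.
move=> b0 m0 ub W pW; have [_ _ /(_ _ _ b0 m0) le] := dual_opt.
rewrite -lee_fin; apply: le_trans (_ : (dual_fun A H sigmac P Rbar beta mu <= _)%E).
  by apply: ereal_sup_ubound; exists W.
apply: le_trans le _; apply: ge_ereal_sup => _ [W' pW' <-].
by rewrite lee_fin ub.
Qed.

Lemma rate_le_trace W : psdmx W ->
  rate H sigmac W <= (l * c)^-1 * rtr (H^t* *m H *m W).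
Proof.
move=> pW; rewrite /rate /log2.
have pG : psdmx ((c^-1)%:C *: (H *m W *m H^t*)).
  apply: psdmxZ; first by rewrite invr_ge0 ltW.
  by have := psdmx_congr (H^t*) pW; rewrite trmxCK.
have pM := psd_posdefD pG (posdefmx1 _ _); rewrite addrC in pM.
have := lndet_le pM; rewrite rtrD rtr1 addrAC subrr add0r rtrZ => le.
rewrite ler_pdivrMr // (le_trans le) //.
rewrite -(mulmxA (H^t*)) [rtr (H^t* *m _)]rtrC.
have -> // : forall x : R, (l * c)^-1 * x * l = c^-1 * x.
by move=> x; field; rewrite !gt_eqF.
Qed.

(** At the dual point (1, b), with b I above H^H H / (l c) + A, the linear bound on the rate makes
    the trace terms together nonpositive. *)
Lemma dual_bounded : exists b, forall W, psdmx W -> Lag beta mu W <= b.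
Proof.
pose G := ((l * c)^-1)%:C *: (H^t* *m H) + A.
have hG : G^t* = G by rewrite /G adjmxD adjmxZ adjmxM trmxCK hA.
have [b [b0 _ pb]] := herm_bound hG.
exists (b * P - Rbar); apply: (@dual_optimal_ub 1 b) => // W pW.
have := psdmx_rtrM_ge0 pb pW.
rewrite mulmxBl -scalemxAl mul1mx rtrB rtrZ /G mulmxDl -scalemxAl rtrD rtrZ.
have := rate_le_trace pW; rewrite /lagrangian /objective -!/(rtr _); lra.
Qed.

Lemma rate_rank1 (s : 'cV[C]_n) (t : R) :
  rate H sigmac (t%:C *: (s *m s^t*)) =
  ln (1 + t * (rtr ((H *m s)^t* *m (H *m s)) / c)) / l.
Proof.
rewrite /rate /log2; congr (ln _ / _).
have -> : ((c^-1)%:C *: (H *m (t%:C *: (s *m s^t*)) *m H^t*)) =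
    ((t / c)%:C *: (H *m s)) *m (H *m s)^t*.
  rewrite -!scalemxAr -!scalemxAl scalerA -rmorphM /= [_^-1 * t]mulrC.
  by rewrite adjmxM !mulmxA.
rewrite det_add1C -scalemxAr [1%:M + _]mx11_scalar det_scalar1 !mxE Re_add.
rewrite eqxx Re_mulr /rtr /mxtrace big_ord1 mxE.
by rewrite mulrAC mulrA.
Qed.

(** Otherwise the Lagrangian along t s s^H has a nonnegative linear part and a logarithm tending to
    infinity. *)
Lemma top_eigenvalue_lt (s : 'cV[C]_n) (a : C) :
  s^t* *m s = 1%:M -> A *m s = a *: s -> H *m s != 0 -> complex.Re a < mu.
Proof.
move=> ss As Hs; have [b ub] := dual_bounded.
rewrite ltNge; apply/negP => le.
set w := rtr ((H *m s)^t* *m (H *m s)) / c.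
have w0 : 0 < w.
  rewrite divr_gt0 // lt_def psdmx_rtr_ge0 ?andbT; last exact: psdmx_adjmul.
  by apply: contra Hs => /eqP /rtr_adjmul_eq0 ->.
have tr1 : rtr (s *m s^t*) = 1 by rewrite rtrC ss rtr1.
have trA : rtr (A *m (s *m s^t*)) = complex.Re a.
  by rewrite mulmxA As -scalemxAl /rtr mxtraceZ mxtrace_mulC ss mxtrace1 mulr1.
(* Chosen so that beta x / l exceeds the bound [b] after the constants in [Rbar] and [P] are
   absorbed; [t] then solves 1 + t w = exp x. *)
pose x := (`|b| + beta * `|Rbar| + mu * `|P| + 1) * l / beta.
have x0 : 0 <= x.
  rewrite divr_ge0 ?(ltW beta_gt0) // mulr_ge0 ?(ltW l_gt0) //.
  by rewrite !addr_ge0 ?mulr_ge0 // ltW.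
pose t := (expR x - 1) / w.
have t0 : 0 <= t by rewrite divr_ge0 ?(ltW w0) // subr_ge0 -expR0 ler_expR.
have pW : psdmx (t%:C *: (s *m s^t*)).
  apply: psdmxZ => //; rewrite -{1}[s]trmxCK; exact: psdmx_adjmul.
have := ub _ pW; rewrite /lagrangian /objective -!/(rtr _) rate_rank1 -/w.
rewrite -scalemxAr !rtrZ trA tr1 mulr1 /t divfK ?gt_eqF // -/t.
have -> : 1 + (expR x - 1) = expR x by ring.
rewrite expRK.
have -> : beta * (x / l - Rbar) =
    `|b| + beta * `|Rbar| + mu * `|P| + 1 - beta * Rbar.
  by rewrite /x; field; rewrite !gt_eqF.
have h1 : 0 <= t * (complex.Re a - mu) by rewrite mulr_ge0 // subr_ge0.
have h2 := ler_norm b.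
have h3 : beta * Rbar <= beta * `|Rbar| by rewrite ler_wpM2l ?ler_norm // ltW.
have h4 : - (mu * `|P|) <= mu * P.
  by rewrite -mulrN ler_wpM2l // lerNl -normrN ler_norm.
lra.
Qed.

Lemma dual_optimal_posdef (s : 'cV[C]_n) :
  unit_top_eigvec A s -> H *m s != 0 -> posdefmx (Qmx A beta mu).
Proof.
move=> [ss [a As top]] Hs; have amu := top_eigenvalue_lt ss As Hs.
have [S [f [SS SS' AE]]] := herm_diag hA.
have fmu i : f i < mu.
  apply: le_lt_trans amu.
  (* [eigenvalue] concerns row vectors; the rows of [S] are left eigenvectors, nonzero because S S^H
     = 1. *)
  have /top : eigenvalue A (f i)%:C.
    apply/eigenvalueP; exists (row i S).
      rewrite -row_mul AE !mulmxA SS mul1mx; apply/rowP => j.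
      by rewrite mxE mul_diag_mx !mxE.
    apply/eqP => r0; have /matrixP/(_ i i) := SS.
    rewrite !mxE eqxx big1 => [/eqP|j _]; first by rewrite eq_sym oner_eq0.
    by have /rowP/(_ j) := r0; rewrite !mxE => ->; rewrite mul0r.
  by rewrite lecE => /andP[].
have -> : Qmx A beta mu = S^t* *m rdiag (fun i => mu / beta - beta^-1 * f i) *m S.
  have -> : rdiag (fun i => mu / beta - beta^-1 * f i) =
      (mu / beta)%:C *: 1%:M - (beta^-1)%:C *: rdiag f.
    by rewrite rdiagZ -rdiag1 rdiagZ rdiagB; apply: eq_rdiag => i; rewrite mulr1.
  rewrite mulmxBr mulmxBl -!scalemxAr -!scalemxAl mulmx1 SS' -AE.
  by rewrite scalemx1.
apply/(posdefmx_diag _ SS SS') => i.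
by rewrite mulrC -mulrBr mulr_gt0 ?invr_gt0 // subr_gt0.
Qed.

(** * Optimality conditions and the closed-form solution *)

Section KKT.
Variables (T : nat) (U : 'M[C]_(m, T)) (h : 'I_T -> R) (V : 'M[C]_(n, T)).
Hypothesis pQ : posdefmx (Qmx A beta mu).
Local Notation S := (inv_sqrtmx (Qmx A beta mu)).
Hypothesis svd : reduced_svd (H *m S) U h V.

Local Notation Wopt := (W_U A sigmac beta mu h V).

Let F := lngram sigmac h V.
Let Zopt := wf_opt sigmac h V.

(* In the coordinates [Z = Q^(1/2) W Q^(1/2)] the Lagrangian at [(beta, mu)] is
   [beta (ln det gram(Z) / ln 2 - tr Z)] up to a constant. *)
Lemma change_of_variables :
  exists2 B : 'M[C]_n, B^t* = B &
  exists f : 'M[C]_n -> 'M[C]_n,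
  [/\ f Wopt = Zopt, forall W, f W = Zopt -> W = Wopt,
      forall W, psdmx W -> psdmx (f W), psdmx Wopt &
      forall W, [/\ rtr W = rtr (B *m f W),
                    objective A W = mu * rtr W - beta * rtr (f W) &
                    rate H sigmac W = F (f W) / l]].
Proof.
have [UU VV h0 HE] := svd.
have [Q2 [hQ2 Q2Q2 Q2S SQ2]] := inv_sqrtmxP pQ.
have hS : S^t* = S.
  by rewrite -[LHS]mulmx1 -Q2S mulmxA -{1}hQ2 -adjmxM Q2S adjmx1 mul1mx.
have WoptE : Wopt = S *m Zopt *m S.
  by rewrite /W_U /Zopt /wf_opt !mulmxA.
have pZ : psdmx Zopt by exact: wf_opt_psd.
move: (inv_sqrtmx _) Q2S SQ2 hS HE WoptE => S0 Q2S SQ2 hS HE WoptE.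
have fK W : S0 *m (Q2 *m W *m Q2) *m S0 = W.
  by rewrite !mulmxA SQ2 mul1mx -(mulmxA W) Q2S mulmx1.
have Kf Z : Q2 *m (S0 *m Z *m S0) *m Q2 = Z.
  by rewrite !mulmxA Q2S mul1mx -(mulmxA Z) SQ2 mulmx1.
exists (S0 *m S0); first by rewrite adjmxM hS.
exists (fun W => Q2 *m W *m Q2); split.
- by rewrite WoptE Kf.
- by move=> W fW; rewrite WoptE -fW fK.
- by move=> W pW; have := psdmx_congr Q2 pW; rewrite hQ2.
- by rewrite WoptE; have := psdmx_congr S0 pZ; rewrite hS.
move=> W; split.
- by rewrite -{1}[W]fK [LHS]rtrC mulmxA.
- have -> : rtr (Q2 *m W *m Q2) = rtr (Qmx A beta mu *m W).
    by rewrite -Q2Q2 [LHS]rtrC mulmxA.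
  rewrite /Qmx mulmxBl mul_scalar_mx -scalemxAl rtrB !rtrZ /objective -/(rtr _).
  by field; rewrite gt_eqF.
rewrite /rate /log2 /F /lngram /gram; congr (ln (complex.Re _) / _).
set D := rdiag _; have hD : D^t* = D by exact: adjmx_rdiag.
(* Then U^H U = 1 and Sylvester's identity reduce the determinant to that of [gram]. *)
have HE' : H = U *m D *m V^t* *m Q2.
  by rewrite -[LHS]mulmx1 -SQ2 mulmxA HE.
have -> : (c^-1)%:C *: (H *m W *m H^t*) =
    U *m ((c^-1)%:C *: (D *m (V^t* *m (Q2 *m W *m Q2) *m V) *m D)) *m U^t*.
  by rewrite -scalemxAr -scalemxAl HE' !adjmxM trmxCK hQ2 hD !mulmxA.
by rewrite det_add1C mulmxA UU mul1mx.
Qed.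

(** Dual minimality makes the Lagrangian maximizer feasible with complementary slackness, so weak
    duality proves it optimal; any other optimum also maximizes the Lagrangian and coincides with
    it. *)
Lemma W_U_unique_optimal W :
  P4_optimal A H sigmac P Rbar W <-> W = Wopt.
Proof.
have [_ VV h0 _] := svd.
have [B hB [f [fopt finj fpsd popt fE]]] := change_of_variables.
have [tropt objopt rateopt] := fE Wopt.
pose r W := rate H sigmac W.
have LE b' m' W' : Lag b' m' W' = mu * rtr W' - beta * rtr (f W')
    + b' * (r W' - Rbar) - m' * (rtr W' - P).
  by have [_ o _] := fE W'; rewrite /lagrangian o.
have rE W' : l * r W' = F (f W').
  by have [_ _ e] := fE W'; rewrite /r e mulrC divfK // gt_eqF.
(* Scaling beta by 1 + e at fixed mu divides Q by 1 + e. *)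
have first_beta (e : R) : -1 < e ->
    0 <= e * (r Wopt - Rbar) + T%:R / l * e ^+ 2.
  move=> e1.
  have b1 : 0 < beta * (1 + e) by rewrite mulr_gt0 //; lra.
  pose M := Lag beta mu Wopt
    + beta * (e * (r Wopt - Rbar) + T%:R / l * e ^+ 2).
  have : Lag beta mu Wopt <= M.
    apply: (dual_optimal_ub b1 mu_ge0) => // W' pW'.
    have := wf_opt_scale sigmac_gt0 h0 VV (fpsd _ pW') e1.
    rewrite -/F -/Zopt -fopt -!rE /M !LE => le.
    have Tl : T%:R = l * (T%:R / l) by rewrite mulrC divfK // gt_eqF.
    have {}le : (1 + e) * r W' - rtr (f W') <=
        r Wopt - rtr (f Wopt) + e * r Wopt + T%:R / l * e ^+ 2.
      rewrite -(ler_pM2l l_gt0); move: le; rewrite {1}Tl.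
      move: (T%:R / l) (r W') (r Wopt) (rtr (f W')) (rtr (f Wopt)).
      by move=> *; lra.
    exact: lagrangian_beta_step.
  by rewrite /M lerDl pmulr_rge0.
(* As beta > 0, steps of both signs are admissible, so the slope in beta is zero. *)
have rate_tight : r Wopt = Rbar.
  have g0 : 0 <= T%:R / l by rewrite divr_ge0 // ltW.
  apply/eqP; rewrite -subr_eq0 eq_le; apply/andP; split.
    rewrite -oppr_ge0; apply: (@first_order_ge0 _ _ 2^-1 _ g0) => // e /andP[e0 e1].
    have /first_beta : -1 < - e by lra.
    by rewrite mulNr mulrN sqrrN.
  apply: (@first_order_ge0 _ _ 2^-1 _ g0) => // e /andP[e0 e1].
  by apply: first_beta; lra.
have [g [eta [g0 eta0 pert]]] := wf_opt_perturb sigmac_gt0 h0 VV hB.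
(* Moving mu by beta t adds t I to Q, that is, t B to the trace weight in the Z coordinates. *)
have first_mu (t : R) : `|t| <= eta -> 0 <= mu + beta * t ->
    0 <= t * (P - rtr Wopt) + g / l * t ^+ 2.
  move=> te m1.
  pose M := Lag beta mu Wopt
    + beta * (t * (P - rtr Wopt) + g / l * t ^+ 2).
  have : Lag beta mu Wopt <= M.
    apply: (dual_optimal_ub beta_gt0 m1) => // W' pW'.
    have := pert _ _ te (fpsd _ pW').
    have [tr' _ _] := fE W'.
    rewrite -/F -/Zopt -fopt -!rE /M !LE -tr' -tropt => le.
    have gl : g = l * (g / l) by rewrite mulrC divfK // gt_eqF.
    have {}le : r W' - rtr (f W') - t * rtr W' <=
        r Wopt - rtr (f Wopt) - t * rtr Wopt + g / l * t ^+ 2.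
      rewrite -(ler_pM2l l_gt0); move: le; rewrite {1}gl.
      move: (g / l) (r W') (r Wopt) (rtr (f W')) (rtr (f Wopt)).
      by move: (rtr W') (rtr Wopt) => *; lra.
    exact: lagrangian_mu_step.
  by rewrite /M lerDl pmulr_rge0.
have gl0 : 0 <= g / l by rewrite divr_ge0 // ltW.
have power : rtr Wopt <= P.
  rewrite -subr_ge0; apply: (@first_order_ge0 _ _ eta _ gl0) => // e /andP[e0 e1].
  apply: first_mu; first by rewrite ger0_norm // ltW.
  by rewrite addr_ge0 // mulr_ge0 // ltW.
(* When mu > 0, backward steps up to mu / beta are admissible too, which gives the reverse
   inequality. *)
have slackness : mu * (rtr Wopt - P) = 0.
  have [->|mu0] := eqVneq mu 0; first by rewrite mul0r.
  have {mu0} mu_gt0 : 0 < mu by rewrite lt_def mu0.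
  suff Ple : 0 <= rtr Wopt - P.
    by apply/eqP; rewrite mulf_eq0 [X in _ || X]eq_le Ple subr_le0 power orbT.
  have e0 : 0 < Num.min eta (mu / beta) by rewrite lt_min eta0 divr_gt0.
  apply: (first_order_ge0 e0 gl0) => e /andP[ep]; rewrite le_min => /andP[e1 e2].
  have := first_mu (- e); rewrite normrN ger0_norm ?(ltW ep) // => /(_ e1).
  rewrite sqrrN mulNr -mulrN opprB; apply.
  by rewrite mulrN subr_ge0 mulrC -ler_pdivlMr.
have Lopt : Lag beta mu Wopt = objective A Wopt.
  rewrite /lagrangian -/(r _) rate_tight -/(rtr _) slackness subrr mulr0.
  by rewrite addr0 subr0.
have feasible : P4_feasible H sigmac P Rbar Wopt.
  by split=> //; rewrite -/(r _) rate_tight.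
have objL W' : P4_feasible H sigmac P Rbar W' -> objective A W' <= Lag beta mu W'.
  move=> [r' p' _]; rewrite /lagrangian.
  rewrite -addrA lerDl -mulrN opprB addr_ge0 // mulr_ge0 ?subr_ge0 //.
  exact: ltW.
have LZ W' : Lag beta mu W' =
    beta / l * (F (f W') - l * rtr (f W')) + (mu * P - beta * Rbar).
  by rewrite LE -rE; field; rewrite gt_eqF.
have bl : 0 < beta / l by rewrite divr_gt0.
have Lmax W' : psdmx W' -> Lag beta mu W' <= Lag beta mu Wopt.
  move=> pW'; rewrite !LZ lerD2r ler_pM2l // fopt.
  exact: (wf_opt_max sigmac_gt0 h0 VV (fpsd _ pW')).
split=> [[fW optW]|->]; last first.
  split=> // W' fW'; rewrite -Lopt (le_trans (objL _ fW')) // Lmax //.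
  by case: fW'.
have [_ _ pW] := fW; apply: finj.
apply: (wf_opt_uniq sigmac_gt0 h0 VV (fpsd _ pW)).
have : Lag beta mu W = Lag beta mu Wopt.
  apply/eqP; rewrite eq_le Lmax //= Lopt.
  exact: le_trans (optW _ feasible) (objL _ fW).
by rewrite !LZ fopt => /addIr /(mulfI (lt0r_neq0 bl)).
Qed.

End KKT.
End Problem.

(** * Hermitian symmetry of the sensing matrix *)

(** No integrability is assumed: negation swaps the positive and negative parts, and [fine] sends
    infinite values to 0 on both sides. *)
Lemma Rintegral_opp (f : R -> R) :
  \int[lebesgue_measure]_(t in setT) (- f t) =
  - \int[lebesgue_measure]_(t in setT) f t.
Proof.
have fineB (x y : \bar R) : fine (x - y)%E = - fine (y - x)%E.
  case: x => [x||]; case: y => [y||] //=; rewrite ?oppr0 //; ring.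
pose F : R -> \bar R := EFin \o f; pose mu := @lebesgue_measure R.
have iN : (\int[mu]_(t in setT) (\- F) t =
    \int[mu]_(t in setT) F^\- t - \int[mu]_(t in setT) F^\+ t)%E.
  by rewrite integralE funeposN funenegN.
have iF : (\int[mu]_(t in setT) F t =
    \int[mu]_(t in setT) F^\+ t - \int[mu]_(t in setT) F^\- t)%E.
  exact: integralE.
by rewrite /Rintegral [X in fine X = _]iN [X in _ = - fine X]iF fineB.
Qed.

Lemma Cintegral_conj (f g : R -> C) : (forall t, g t = (f t)^*) ->
  Cintegral g = (Cintegral f)^*.
Proof.
move=> gf; rewrite /Cintegral.
have -> : (fun t => complex.Re (g t)) = (fun t => complex.Re (f t)).
  by apply/funext => t; rewrite gf; case: (f t).
have -> : (fun t => complex.Im (g t)) = (fun t => - complex.Im (f t)).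
  by apply/funext => t; rewrite gf; case: (f t).
by rewrite Rintegral_opp.
Qed.

Lemma A1mx_herm Nt Nr (d lambda cphi : R) (pdf : R -> R) :
  (A1mx Nt Nr d lambda cphi pdf)^t* = A1mx Nt Nr d lambda cphi pdf.
Proof.
apply/matrixP => i j; rewrite !mxE; apply/esym/Cintegral_conj => t.
have hW : ((sqnorm (dsteering Nr d lambda cphi t) * pdf t)%:C *:
    (steering Nt d lambda cphi t *m (steering Nt d lambda cphi t)^t*))^t* =
  (sqnorm (dsteering Nr d lambda cphi t) * pdf t)%:C *:
    (steering Nt d lambda cphi t *m (steering Nt d lambda cphi t)^t*).
  by rewrite adjmxZ adjmxM trmxCK.
by rewrite -{1}hW !mxE.
Qed.

End Duality.

Theorem proposition4 (R : realType) (Nt Nr Nu K : nat)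
  (Nt_gt0 : (0 < Nt)%N) (Nr_gt0 : (0 < Nr)%N) (Nu_gt0 : (0 < Nu)%N)
  (K_gt0 : (0 < K)%N)
  (d lambda r hB : R)
  (d_gt0 : 0 < d) (lambda_gt0 : 0 < lambda) (r_gt0 : 0 < r)
  (hB_ge0 : 0 <= hB) (hB_le_r : hB <= r)
  (p theta sigma : 'I_K -> R)
  (p_ge0 : forall k, 0 <= p k <= 1) (p_sum1 : \sum_(k < K) p k = 1)
  (theta_range : forall k, - (pi / 2) <= theta k < pi / 2)
  (sigma_gt0 : forall k, 0 < sigma k)
  (H : 'M[R[i]]_(Nu, Nt)) (sigmac P Rbar Rmax beta mu : R)
  (s1 : 'cV[R[i]]_Nt)
  (sigmac_gt0 : 0 < sigmac) (P_gt0 : 0 < P) :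
  let A1 := A1mx Nt Nr d lambda (cos_elevation r hB)
              (mixture_pdf p theta sigma) in
  unit_top_eigvec A1 s1 ->
  H *m s1 != 0 ->
  is_max (achievable_rates H sigmac P) Rmax ->
  rate_sensing H sigmac P s1 < Rbar -> Rbar <= Rmax ->
  dual_optimal A1 H sigmac P Rbar beta mu ->
  let Q := Qmx A1 beta mu in
  posdefmx Q /\
  forall (U : 'M[R[i]]_(Nu, \rank H)) (h : 'I_(\rank H) -> R)
         (V : 'M[R[i]]_(Nt, \rank H)),
    reduced_svd (H *m inv_sqrtmx Q) U h V ->
    forall W : 'M[R[i]]_Nt,
      P4_optimal A1 H sigmac P Rbar W <-> W = W_U A1 sigmac beta mu h V.
Proof.
move=> A1 top Hs1 _ _ _ opt Q.
have hA : A1^t* = A1 by exact: A1mx_herm.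
(* The nonzero H s1 makes the rate grow along s1, which gives the strictness in Q > 0. *)
have pQ := dual_optimal_posdef sigmac_gt0 hA opt top Hs1.
by split=> // U h V svd W; apply: W_U_unique_optimal svd W.
Qed.
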